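(* Let $n,k\ge0$ be integers and $t$ a positive integer such that $n=kt+l$ with $1\le l\le t$. Then $$\Delta_{n,t}^{[k]}\simeq\bigvee_{\binom{k}{l}}S^{l-1},$$ a wedge of $\binom{k}{l}$ spheres of dimension $l-1$, where the right-hand side is a point if $k<l$.
   Context: Let $K$ be a field, $R=K[x_1,\dots,x_n]$, $[n]=\{1,\dots,n\}$. The $t$-path ideal $I_{n,t}$ of the path graph on $[n]$ is generated by $x_ix_{i+1}\cdots x_{i+t-1}$ for $1\le i\le n-t+1$. For $k\ge1$, the $k$-th squarefree power $I_{n,t}^{[k]}$ is generated by the squarefree monomials in the minimal generating set of $I_{n,t}^k$, i.e. by products of $k$ of these generators with pairwise disjoint supports. Its Stanley--Reisner complex $\Sigma_{n,t}^{[k]}$ consists of the $F\subseteq[n]$ with $\prod_{i\in F}x_i\notin I_{n,t}^{[k]}$. $\Delta_{n,t}^{[k]}=\{[n]\setminus F: F\subseteq[n],\ F\notin\Sigma_{n,t}^{[k]}\}$ is the Alexander dual of $\Sigma_{n,t}^{[k]}$. For $k=0$, $\Delta_{n,t}^{[0]}$ is by convention the full simplex on $\{1,\dots,n\}$. $\simeq$ denotes homotopy equivalence (of geometric realizations). *)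

(* Defs.v *)
From HB Require Import structures.
From mathcomp Require Import all_boot all_order all_algebra.
From mathcomp Require mpoly.

Set Implicit Arguments.
Unset Strict Implicit.
Unset Printing Implicit Defensive.

Import GRing.Theory.

(* The vertex set [n] = {1, ..., n} is 'I_n, so all vertices are shifted by 1. *)

(* mpoly is imported in this module only: its notations clash with those of
   mathcomp-analysis. *)
Module PathIdeal.
Import mpoly.
Local Open Scope ring_scope.

Section Ideals.
Variables (K : fieldType) (n : nat).
Local Notation Rn := {mpoly K[n]}.

Definition ideal_gen (G : Rn -> Prop) : Rn -> Prop := fun p =>
  exists (m : nat) (a g : 'I_m -> Rn),
    (forall j, G (g j)) /\ p = \sum_(j < m) a j * g j.

Definition ideal_pow (I : Rn -> Prop) (k : nat) : Rn -> Prop :=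
  ideal_gen (fun p => exists f : 'I_k -> Rn,
    (forall j, I (f j)) /\ p = \prod_(j < k) f j).

(* For a monomial ideal I, the exponents of its unique minimal set of monomial
   generators: the monomials of I that are minimal for divisibility. *)
Definition min_generator (I : Rn -> Prop) (m : 'X_{1..n}) : Prop :=
  I 'X_[m] /\
  forall m' : 'X_{1..n}, (m' <= m)%MM -> I 'X_[m'] -> m' = m.

Definition squarefree (m : 'X_{1..n}) : Prop := forall i, (m i <= 1)%N.

Definition squarefree_pow (I : Rn -> Prop) (k : nat) : Rn -> Prop :=
  ideal_gen (fun p => exists m : 'X_{1..n},
    [/\ min_generator (ideal_pow I k) m, squarefree m & p = 'X_[m]]).

Definition path_ideal (t : nat) : Rn -> Prop :=
  ideal_gen (fun p => exists i : nat,
    (i + t <= n)%N /\ p = \prod_(j < n | (i <= j < i + t)%N) 'X_j).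

Definition stanley_reisner (I : Rn -> Prop) (F : {set 'I_n}) : Prop :=
  ~ I (\prod_(i in F) 'X_i).

End Ideals.
End PathIdeal.

From mathcomp Require Import all_classical all_reals topology normedtype homotopy.
Import numFieldNormedType.Exports.
Import Order.TTheory Num.Theory.

Local Open Scope classical_set_scope.
Local Open Scope ring_scope.

(* A simplicial complex on [n] is the set of its faces, empty face included. *)
Definition alexander_dual (n : nat) (S : set {set 'I_n}) : set {set 'I_n} :=
  [set ~: F | F in ~` S].

Definition Sigma (K : fieldType) (n t k : nat) : set {set 'I_n} :=
  PathIdeal.stanley_reisner
    (PathIdeal.squarefree_pow (@PathIdeal.path_ideal K n t) k).
Arguments Sigma : clear implicits.

Definition Delta (K : fieldType) (n t k : nat) : set {set 'I_n} :=
  if k == 0%N then setT else alexander_dual (Sigma K n t k).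
Arguments Delta : clear implicits.

(* Barycentric coordinates, with the topology induced from R^n. *)
Definition realization (R : realType) (n : nat) (D : set {set 'I_n}) :
    topologicalType :=
  set_type [set x : 'rV[R]_n |
    [/\ forall i, 0 <= x ord0 i, \sum_i x ord0 i = 1
      & D [set i | x ord0 i != 0]%SET]].

Definition homotopic (R : realType) (X Y : topologicalType) (f g : X -> Y) :
    Prop :=
  exists H : X * R -> Y,
    [/\ {within [set: X] `*` `[0, 1]%classic, continuous H},
        forall x, H (x, 0) = f x & forall x, H (x, 1) = g x].

Definition homotopy_equiv (R : realType) (X Y : topologicalType) : Prop :=
  exists (f : X -> Y) (g : Y -> X),
    [/\ continuous f, continuous g,
        homotopic R (g \o f) idfun & homotopic R (f \o g) idfun].

Definition sphere_set (R : realType) (d : nat) : set 'rV[R]_d.+1 :=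
  [set x : 'rV[R]_d.+1 | \sum_i x ord0 i ^+ 2 = 1].
Arguments sphere_set : clear implicits.

Definition sphere (R : realType) (d : nat) : topologicalType :=
  set_type (sphere_set R d).

Lemma sphere_base_subproof (R : realType) (d : nat) :
  (delta_mx ord0 ord0 : 'rV[R]_d.+1) \in sphere_set R d.
Proof.
rewrite inE /sphere_set /= (bigD1 ord0) //= big1 ?addr0; last first.
  by move=> i i0; rewrite mxE (negbTE i0) andbF expr0n.
by rewrite mxE !eqxx expr1n.
Qed.

Definition sphere_base (R : realType) (d : nat) : sphere R d :=
  exist (fun x => x \in sphere_set R d) _ (sphere_base_subproof R d).

(* The library's wedge over an empty index type is empty, whereas the wedge of
   no spheres is a point. *)
Definition sphere_wedge (R : realType) (c d : nat) : topologicalType :=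
  if c == 0%N then discrete_topology unit : topologicalType
  else wedge (fun _ : 'I_c => sphere_base R d).

(* Main.v *)
(* A face of Delta_{n,t}^{[k]} is a set whose complement contains k disjoint
   blocks of t consecutive vertices.  Writing a vertex (counted from 0) as i + t b,
   this means that all its vertices have i < l and that b is a weakly increasing
   function of i: a face is a partial weakly increasing sequence of levels
   b in {0, ..., k}, indexed by the rows i in {0, ..., l-1}.

   The binom(k, l) spheres come from the strict sequences 0 < c_0 < ... < c_{l-1} <= k.
   With c_{-1} = 0, the join S_c of the pairs {(i, c_{i-1}), (i, c_i)} is a
   cross-polytope through the apex (0, 0) whose only strict facet is F_c.  Let A be
   the subcomplex left after removing the interiors of all the F_c.  A face of A
   starts with a maximal strict sequence c_0 < ... < c_{i-1} whose next level is
   missing or equal to c_{i-1}; toggling the vertex (i, c_{i-1}) is an acyclic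
   matching of the nonempty faces other than the apex.  The corresponding
   collapses, done for i = l-1, ..., 0, extend to one homotopy of the whole complex
   that starts at the identity, preserves every S_c, fixes the apex, and sends A to
   the apex at time 1.  Its end map factors through the wedge of the quotients
   F_c / boundary, which gives a homotopy equivalence with the wedge of the S_c. *)
Require Import Defs.
From HB Require Import structures.
From mathcomp Require Import all_boot all_order all_algebra.
From mathcomp Require mpoly.
From mathcomp Require Import zify.

Set Implicit Arguments.
Unset Strict Implicit.
Unset Printing Implicit Defensive.

Import Order.TTheory GRing.Theory.

(** * Squarefree powers of path ideals *)

Lemma sum_interval (n a c : nat) :
  (a <= c)%N -> (c <= n)%N -> (\sum_(i < n) (a <= i < c) = c - a)%N.
Proof.
move=> ac cn; have -> : (c - a = \sum_(a <= i < c) 1)%N.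
  by rewrite sum_nat_const_nat muln1.
rewrite (big_nat_widen _ _ n) // big_geq_mkord /= [RHS]big_mkcond /=.
by apply: eq_bigr => i _; case: (_ < _)%N; case: (_ <= _)%N.
Qed.

(** [p q] is the first vertex of the [q]-th block. For an exponent vector [m], a packing is a
    product of [k] path generators dividing the monomial; for the indicator of a set, it is a family
    of disjoint blocks inside the set. *)
Definition path_packing (n t k : nat) (p : 'I_k -> nat) (m : 'I_n -> nat) :=
  (forall q, p q + t <= n)%N /\
  (forall i : 'I_n, \sum_q (p q <= i < p q + t) <= m i)%N.

Module SquarefreePower.
Import mpoly PathIdeal.
Local Open Scope ring_scope.

Section Membership.
Variables (K : fieldType) (n t : nat).
Local Notation path_ideal := (@path_ideal K n t).

Definition path_exp (a : nat) : 'X_{1..n} :=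
  [multinom (a <= i < a + t)%N : nat | i < n].

Lemma path_generatorE (a : nat) :
  \prod_(j < n | (a <= j < a + t)%N) 'X_j = 'X_[path_exp a] :> {mpoly K[n]}.
Proof.
rewrite mpolyXE_id big_mkcond; apply: eq_bigr => i _.
by rewrite mnmE; case: ifP; rewrite (expr1, expr0).
Qed.

Definition indicator_exp (G : {set 'I_n}) : 'X_{1..n} :=
  [multinom (i \in G : nat) | i < n].

Lemma indicator_monomialE (G : {set 'I_n}) :
  \prod_(i in G) 'X_i = 'X_[indicator_exp G] :> {mpoly K[n]}.
Proof.
rewrite mpolyXE_id big_mkcond; apply: eq_bigr => i _.
by rewrite mnmE; case: ifP; rewrite (expr1, expr0).
Qed.

Lemma ideal_gen_mem (G : {mpoly K[n]} -> Prop) g : G g -> ideal_gen G g.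
Proof.
move=> Gg; exists 1%N, (fun=> 1), (fun=> g); split=> //.
by rewrite big_ord1 mul1r.
Qed.

Lemma ideal_gen_mull (G : {mpoly K[n]} -> Prop) a g :
  G g -> ideal_gen G (a * g).
Proof.
by move=> Gg; exists 1%N, (fun=> a), (fun=> g); split=> //; rewrite big_ord1.
Qed.

(** A monomial of a sum occurs in one summand, and a monomial of a product is a product of
    monomials. Membership is thereby reduced to divisibility of exponents. *)
Lemma ideal_gen_msupp (G : {mpoly K[n]} -> Prop) f m :
  ideal_gen G f -> m \in msupp f ->
  exists g m', [/\ G g, m' \in msupp g & (m' <= m)%MM].
Proof.
move=> [N [a [g [Gg ->]]]] /msupp_sum_le /flattenP[s /mapP[j _ ->]].
move=> /msuppM_le /allpairsP[[m1 m2] /= [_ m2g ->]].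
by exists (g j), m2; split=> //; exact: lem_addl.
Qed.

Lemma path_ideal_msupp f m : path_ideal f -> m \in msupp f ->
  exists2 a, (a + t <= n)%N & (path_exp a <= m)%MM.
Proof.
move=> If /(ideal_gen_msupp If)[g [m' [[a [an ->]]]]].
by rewrite path_generatorE msuppX inE => /eqP -> am; exists a.
Qed.

Lemma path_ideal_prod_msupp k (f : 'I_k -> {mpoly K[n]}) m :
  (forall j, path_ideal (f j)) -> m \in msupp (\prod_j f j) ->
  exists p, path_packing t (p : 'I_k -> nat) m.
Proof.
elim: k f m => [|k IHk] f m If.
  by exists (fun=> 0%N); split=> [[]//|i]; rewrite big_ord0.
rewrite big_ord_recl => /msuppM_le /allpairsP[[m1 m2] /= [m1f m2f ->]].
have [a an am1] := path_ideal_msupp (If _) m1f.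
have [p [pn pm2]] := IHk (fun j => f (lift ord0 j)) m2 (fun=> If _) m2f.
exists (fun q => oapp p a (unlift ord0 q)); split=> [q|i].
  by case: unliftP => [q'|] _ /=; [exact: pn|].
rewrite big_ord_recl unlift_none /= mnmDE leq_add //.
  by have /mnm_lepP/(_ i) := am1; rewrite mnmE.
apply: leq_trans (pm2 i); rewrite leq_eqVlt; apply/orP; left; apply/eqP.
by apply: eq_bigr => q _; rewrite liftK.
Qed.

Lemma ideal_pow_msupp k f m : ideal_pow path_ideal k f -> m \in msupp f ->
  exists p, path_packing t (p : 'I_k -> nat) m.
Proof.
move=> If /(ideal_gen_msupp If)[_ [m' [[g [Ig ->]] /(path_ideal_prod_msupp Ig)]]].
move=> [p [pn pm']] /mnm_lepP m'm; exists p; split=> // i.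
exact: leq_trans (pm' i) (m'm i).
Qed.

Lemma ideal_pow_packing k (p : 'I_k -> nat) : (forall q, p q + t <= n)%N ->
  ideal_pow path_ideal k 'X_[\sum_q path_exp (p q)].
Proof.
move=> pn; apply: ideal_gen_mem; exists (fun q => 'X_[path_exp (p q)]); split.
  by move=> q; apply: ideal_gen_mem; exists (p q); rewrite path_generatorE.
by rewrite (big_morph _ (@mpolyXD n K) (@mpolyX0 n K)).
Qed.

Lemma mdeg_path_exp a : (a + t <= n)%N -> mdeg (path_exp a) = t.
Proof.
move=> an; rewrite mdegE (eq_bigr (fun i : 'I_n => (a <= i < a + t) : nat)).
  by rewrite sum_interval ?leq_addr // addKn.
by move=> i _; rewrite mnmE.
Qed.

Lemma packing_sum_le k (p : 'I_k -> nat) (m : 'X_{1..n}) :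
  path_packing t p m -> (\sum_q path_exp (p q) <= m)%MM.
Proof.
move=> [_ pm]; apply/mnm_lepP => i; rewrite mnm_sumE.
by rewrite (eq_bigr (fun q => (p q <= i < p q + t) : nat)) // => q _; rewrite mnmE.
Qed.

Lemma mdeg_packing_sum k (p : 'I_k -> nat) : (forall q, p q + t <= n)%N ->
  mdeg (\sum_q path_exp (p q)) = (k * t)%N.
Proof.
move=> pn; rewrite mdeg_sum (eq_bigr (fun=> t)) => [|q _].
  by rewrite sum_nat_const card_ord.
exact: mdeg_path_exp.
Qed.

Lemma lem_mdeg_eq (m m' : 'X_{1..n}) :
  (m' <= m)%MM -> (mdeg m <= mdeg m')%N -> m' = m.
Proof.
move=> m'm; rewrite -{1 2}(submK m'm) mdegD -{2}[mdeg m']add0n leq_add2r leqn0.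
by rewrite mdeg_eq0 => /eqP ->; rewrite add0m.
Qed.

(** For the converse, a product of [k] path generators has degree [k * t], and every monomial of the
    [k]-th power is divisible by such a product; minimality follows by comparing degrees. *)
Lemma squarefree_pow_packing k (G : {set 'I_n}) :
  squarefree_pow path_ideal k (\prod_(i in G) 'X_i) <->
  exists p : 'I_k -> nat, path_packing t p (fun i => i \in G).
Proof.
rewrite indicator_monomialE; split.
  move=> IG; have [] := ideal_gen_msupp (m := indicator_exp G) IG.
    by rewrite msuppX inE.
  move=> _ [m' [[m [[Im _] _ ->]]]].
  rewrite msuppX inE => /eqP -> /mnm_lepP mG.
  have [p [pn pm]] : exists p, path_packing t (p : 'I_k -> nat) m.
    by apply: ideal_pow_msupp Im _; rewrite msuppX inE.
  exists p; split=> // i; apply: leq_trans (pm i) _.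
  by have := mG i; rewrite mnmE.
move=> [p [pn pG]]; set m := (\sum_q path_exp (p q))%MM.
have mG : (m <= indicator_exp G)%MM.
  by apply: packing_sum_le; split=> // i; rewrite mnmE.
rewrite -(submK mG) mpolyXD; apply: ideal_gen_mull; exists m; split=> //.
  split; first exact: ideal_pow_packing.
  move=> m' m'm Im'; apply: (lem_mdeg_eq m'm).
  have [p' pp'] : exists p', path_packing t (p' : 'I_k -> nat) m'.
    by apply: ideal_pow_msupp Im' _; rewrite msuppX inE.
  rewrite mdeg_packing_sum // -(mdeg_packing_sum pp'.1).
  by rewrite -(submK (packing_sum_le pp')) mdegD leq_addl.
move=> i; have /mnm_lepP/(_ i) := mG; rewrite mnmE.
by move=> /leq_trans; apply; case: (i \in G).
Qed.

End Membership.
End SquarefreePower.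

From mathcomp Require Import all_classical all_reals topology normedtype.
From mathcomp Require Import homotopy realfun.
From mathcomp Require Import lra.
Import Num.Theory numFieldNormedType.Exports.

Local Open Scope classical_set_scope.

(** * The faces of the dual complex *)

Lemma Delta_packing (K : fieldType) (n t k : nat) (F : {set 'I_n}) :
  Delta K n t k F <->
  exists p : 'I_k -> nat, path_packing t p (fun i => i \notin F).
Proof.
rewrite /Delta; case: eqP => [->|_].
  (* The empty packing always exists, in accordance with the convention for [k = 0]. *)
  by split=> // _; exists (fun=> 0%N); split=> [[]//|i]; rewrite big_ord0.
rewrite /alexander_dual /Sigma /PathIdeal.stanley_reisner /=; split.
  move=> [G /contrapT /SquarefreePower.squarefree_pow_packing [p [pn pG]] <-].
  by exists p; split=> // i; rewrite finset.inE negbK.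
move=> [p [pn pF]]; exists (finset.setC F); last by rewrite finset.setCK.
apply; apply/SquarefreePower.squarefree_pow_packing; exists p; split=> // i.
by rewrite finset.inE.
Qed.

(** Double counting of the pairs of a block and a vertex in it: as [m] is at most 1, each vertex
    from [a] to [c - 1] is counted at most once, and no other vertex is counted. *)
Lemma packing_count (n t k : nat) (p : 'I_k -> nat) (m : 'I_n -> nat)
    (Q : pred 'I_k) (a c : nat) :
  path_packing t p m -> (forall i, m i <= 1)%N -> (a <= c <= n)%N ->
  (forall q, Q q -> (a <= p q) && (p q + t <= c))%N -> (#|Q| * t <= c - a)%N.
Proof.
move=> [pn pm] m1 /andP[ac cn] Qac.
rewrite -(sum_interval ac cn) -sum_nat_const.
apply: (@leq_trans (\sum_(q in Q) \sum_(i < n) (p q <= i < p q + t))%N).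
  apply: leq_sum => q _.
  by rewrite sum_interval ?leq_addr // addKn.
rewrite exchange_big /=; apply: leq_sum => i _.
have [iac|niac] := boolP (a <= i < c)%N.
  apply: leq_trans (m1 i); apply: leq_trans (pm i).
  by rewrite big_mkcond; apply: leq_sum => q _; case: ifP.
rewrite leqn0 sum_nat_eq0; apply/forall_inP => q /Qac /andP[apq pqc].
by rewrite eqb0; lia.
Qed.

(** Two vertices of one row, compared in both orders, get the same level, so a face has at most one
    vertex in each row. *)
Definition staircase (n t l : nat) (F : {set 'I_n}) :=
  forall i i' : 'I_n, i \in F -> i' \in F ->
    (i %% t < l)%N /\ ((i %% t <= i' %% t)%N -> (i %/ t <= i' %/ t)%N).

(** [B f] counts the blocks starting at or before [f]. No block contains a vertex [f] of [F], so
    [B f] blocks fit before [f] and the other [k - B f] after it; the two counts give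
    [B f * t <= f < B f * t + l], so [B f] is the level of [f]. *)
Lemma packing_staircase (n t k l : nat) (p : 'I_k -> nat) (F : {set 'I_n}) :
  n = (k * t + l)%N -> (1 <= l <= t)%N ->
  path_packing t p (fun i => i \notin F) -> staircase t l F.
Proof.
move=> nE lt pF; pose B f := #|[pred q | p q <= f]|.
have m1 (i : 'I_n) : ((i \notin F : nat) <= 1)%N by case: (_ \notin _).
have avoid (f : 'I_n) q : f \in F -> (p q + t <= f)%N || (f < p q)%N.
  move=> Ff; have := pF.2 f; rewrite Ff leqn0 sum_nat_eq0.
  by move=> /forall_inP/(_ q isT); rewrite eqb0; lia.
have fB (f : 'I_n) : f \in F -> exists2 j, (j < l)%N & f = (B f * t + j)%N :> nat.
  move=> Ff; have fn := ltn_ord f; exists (f - B f * t)%N.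
    have cB : (B f + #|[pred q | f < p q]%N| = k)%N.
      rewrite -[RHS](card_ord k) -(cardC [pred q | p q <= f]%N); congr addn.
      by apply: eq_card => q; rewrite !inE ltnNge.
    have : (#|[pred q | f < p q]%N| * t <= n - f.+1)%N.
      apply: (packing_count pF m1); first by rewrite leqnn andbT.
      by move=> q /= ->; exact: (pF.1 q).
    by nia.
  rewrite subnKC //.
  have := @packing_count _ _ _ _ _ [pred q | p q <= f]%N 0 f pF m1.
  rewrite subn0; apply; first by rewrite leq0n ltnW.
  by move=> q /= pqf; have := avoid f q Ff; lia.
have divB (f : 'I_n) : f \in F ->
    [/\ (f %% t < l)%N, f %/ t = B f & f = (B f * t + f %% t)%N :> nat].
  move=> /fB [j jl fE]; have jt : (j < t)%N by lia.
  have fm : f %% t = j by rewrite {1}fE modnMDl modn_small.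
  have fd : f %/ t = B f by rewrite {1}fE divnMDl ?divn_small ?addn0 //; lia.
  by rewrite fm fd.
move=> f f' Ff Ff'; have [fl fdiv fE] := divB f Ff.
have [_ f'div f'E] := divB f' Ff'; split=> // jj'; rewrite fdiv f'div.
(* Otherwise [B f - B f'] blocks lie strictly between [f'] and [f], where the order of the two rows
   leaves too little room. *)
rewrite leqNgt; apply/negP => BB.
have f'f : (f' < f)%N by nia.
have BE : B f = (B f' + #|[pred q | f' < p q <= f]%N|)%N.
  rewrite /B -(cardID [pred q | p q <= f']%N [pred q | p q <= f]%N).
  by congr addn; apply: eq_card => q; rewrite !inE; lia.
have fn := ltn_ord f.
have : (#|[pred q | f' < p q <= f]%N| * t <= f - f'.+1)%N.
  apply: (packing_count pF m1); first by lia.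
  by move=> q /= /andP[f'q qf]; have := avoid f q Ff; lia.
by nia.
Qed.

(** Block [q] starts at [q * t + J q], where [J q] is one more than the last row that [F] occupies
    at levels up to [q], or 0 if there is none. Vertices of [F] at later levels have rows at least
    [J q], so they come after the block; monotonicity of [J] keeps the blocks disjoint. *)
Lemma staircase_packing (n t k l : nat) (F : {set 'I_n}) :
  n = (k * t + l)%N -> (1 <= l <= t)%N -> staircase t l F ->
  exists p : 'I_k -> nat, path_packing t p (fun i => i \notin F).
Proof.
move=> nE lt sF.
pose J q := (\max_(i in F | (i %/ t <= q)%N) (i %% t).+1)%N.
have Jl q : (J q <= l)%N by apply/bigmax_leqP => i /andP[Fi _]; have [] := sF i i Fi Fi.
have Jub q (i : 'I_n) : i \in F -> (i %/ t <= q)%N -> (i %% t < J q)%N.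
  move=> Fi iq; rewrite /J (bigD1 i) /=; first exact: leq_maxl.
  by rewrite Fi.
have Jmono q q' : (q <= q')%N -> (J q <= J q')%N.
  move=> qq'; apply/bigmax_leqP => i /andP[Fi iq].
  by apply: Jub => //; exact: leq_trans qq'.
exists (fun q => q * t + J q)%N; split=> [q|i].
  by have := Jl q; have := ltn_ord q; nia.
have [iF|niF] /= := boolP (i \in F).
  rewrite leqn0 sum_nat_eq0; apply/forallP => q; apply/implyP => _; rewrite eqb0.
  have [iq|qi] := leqP (i %/ t) q.
    by have := Jub q i iF iq; have := divn_eq i t; nia.
  have : (J q <= i %% t)%N.
    apply/bigmax_leqP => i' /andP[Fi' i'q]; rewrite ltnNge; apply/negP => ii'.
    by have [_ /(_ ii')] := sF i i' iF Fi'; lia.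
  by have := divn_eq i t; nia.
have [[q qP]|nq] := pselect (exists q : 'I_k,
    (q * t + J q <= i < q * t + J q + t)%N); last first.
  rewrite big1 // => q _; apply/eqP; rewrite eqb0; apply/negP => qi.
  by apply: nq; exists q.
rewrite (bigD1 q) //= big1 ?addn0 ?leq_b1 // => q' q'q.
apply/eqP; rewrite eqb0; apply/negP => q'P.
have := q'q; rewrite -val_eqE /=; case: ltngtP => // qq' _.
  by have := Jmono _ _ (ltnW qq'); nia.
by have := Jmono _ _ (ltnW qq'); nia.
Qed.

Lemma Delta_staircase (K : fieldType) (n k t l : nat) (F : {set 'I_n}) :
  n = (k * t + l)%N -> (1 <= l <= t)%N ->
  Delta K n t k F <-> staircase t l F.
Proof.
move=> nE lt; rewrite Delta_packing; split; last exact: (staircase_packing nE).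
by move=> [p]; exact: (packing_staircase nE).
Qed.

Local Open Scope ring_scope.

(** * Maps into a wedge *)

Lemma set_type_continuous_at (T X : topologicalType) (A : set X)
    (f : T -> set_type A) (x : T) :
  {for x, continuous (set_val \o f)} -> {for x, continuous f}.
Proof.
move=> cf U; rewrite nbhsE => -[_ [[V oV <-] Vx] VU].
have nV : nbhs (set_val (f x)) V by apply: open_nbhs_nbhs; split.
by have := cf _ nV; rewrite /nbhs /=; apply: filterS => y; exact: VU.
Qed.

Lemma set_val_continuous (X : topologicalType) (A : set X) :
  continuous (set_val : set_type A -> X).
Proof. exact: initial_continuous. Qed.

Lemma near_continuous (T U : topologicalType) (f g : T -> U) (x : T) :
  (\forall y \near x, f y = g y) -> {for x, continuous g} ->
  {for x, continuous f}.
Proof.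
move=> fg cg; have fgx : f x = g x := nbhs_singleton fg.
rewrite /prop_for /continuous_at fgx.
apply: cvg_trans cg; apply: near_eq_cvg.
by near=> y; rewrite (near fg y).
Unshelve. all: by end_near. Qed.

Lemma pair_continuous (S T U : topologicalType) (f : S -> T) (g : S -> U) x :
  {for x, continuous f} -> {for x, continuous g} ->
  {for x, continuous (fun y => (f y, g y))}.
Proof. by move=> cf cg; apply: cvg_pair. Qed.

Lemma swap_continuous (T U : topologicalType) :
  continuous (fun q : T * U => (q.2, q.1)).
Proof. by move=> q; apply: pair_continuous; [exact: cvg_snd|exact: cvg_fst]. Qed.

(** Time is reversed because the flow starts at the identity, whereas [homotopy_equiv] puts the
    composite at time 0. *)
Lemma homotopic_swap (R : realType) (X Y : topologicalType) (f g : X -> Y)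
    (H : X * R -> Y) :
  continuous H -> (forall x, H (x, 0) = g x) -> (forall x, H (x, 1) = f x) ->
  homotopic R f g.
Proof.
move=> cH H0 H1; exists (H \o (fun q => (q.1, 1 - q.2))); split=> [|x|x] /=.
- apply: continuous_subspaceT => q; apply: continuous_comp; last exact: cH.
  apply: pair_continuous; first exact: cvg_fst.
  by apply: cvgB; [exact: cvg_cst|exact: cvg_snd].
- by rewrite subr0.
- by rewrite subrr.
Qed.

Lemma homotopy_equiv_homeo (R : realType) (X Y Z : topologicalType)
    (f : X -> Y) (g : Y -> X) :
  continuous f -> continuous g -> cancel f g -> cancel g f ->
  homotopy_equiv R Y Z -> homotopy_equiv R X Z.
Proof.
move=> cf cg fK gK [u [v [cu cv [H [cH H0 H1]] [G [cG G0 G1]]]]].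
exists (u \o f), (g \o v); split.
- by move=> x; apply: continuous_comp; [exact: cf|exact: cu].
- by move=> x; apply: continuous_comp; [exact: cv|exact: cg].
- exists (fun q => g (H (f q.1, q.2))); split=> [|x|x]; last 2 first.
  + by rewrite H0.
  + by rewrite H1 fK.
  (* [H] is continuous only relative to times in [[0, 1]], so its continuity is transported through
     relative neighbourhoods. *)
  apply/subspace_continuousP => -[x s] /= [_ s01] V nV.
  have cfs : {for (x, s), continuous (fun q : X * R => (f q.1, q.2))}.
    apply: pair_continuous; last exact: cvg_snd.
    by apply: (@continuous_comp _ _ _ fst f); [exact: cvg_fst|exact: cf].
  have /subspace_continuousP/(_ (f x, s) (conj I s01)) cHx := cH.
  have {}/cHx := cg (H (f x, s)) V nV.
  rewrite /nbhs /= /within /= => nW; have := cfs _ nW.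
  by rewrite /nbhs /=; apply: filterS => -[y r] /= + [_ r01]; apply.
- by exists G; split => // x; rewrite G0 /= gK.
Qed.

Lemma contractible_equiv (R : realType) (X : topologicalType) (p : X)
    (H : X * R -> X) :
  continuous H -> (forall x, H (x, 0) = x) -> (forall x, H (x, 1) = p) ->
  homotopy_equiv R X (discrete_topology unit).
Proof.
move=> cH H0 H1; exists (fun=> tt), (fun=> p); split.
- by move=> x; exact: cvg_cst.
- by move=> x; exact: cvg_cst.
- exact: homotopic_swap cH H0 H1.
- exists (fun=> tt); split=> [|[]|[]] //.
  by apply: continuous_subspaceT => x; exact: cvg_cst.
Qed.

Section WedgeEquivalence.
Variables (R : realType) (X Y : topologicalType) (y0 : Y) (c : nat) (p : X).
Variables (H : X * R -> X) (S U : 'I_c -> set X).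
Variables (g : 'I_c -> Y -> X) (r : 'I_c -> X -> Y).
Hypothesis c_gt0 : (0 < c)%N.
Hypothesis y0_closed : closed [set y0].
Hypothesis H_continuous : continuous H.
Hypothesis H0 : forall x, H (x, 0) = x.
Hypothesis H1 : forall x, (forall i, ~ U i x) -> H (x, 1) = p.
Hypothesis Hp : forall s, H (p, s) = p.
Hypothesis HS : forall i x s, S i x -> S i (H (x, s)).
Hypothesis U_open : forall i, open (U i).
Hypothesis US : forall i, U i `<=` S i.
Hypothesis SU_eq : forall i j x, S i x -> U j x -> i = j.
Hypothesis g_continuous : forall i, continuous (g i).
Hypothesis gS : forall i y, S i (g i y).
Hypothesis gp : forall i, g i y0 = p.
Hypothesis gK : forall i, cancel (g i) (r i).
Hypothesis rK : forall i x, S i x -> g i (r i x) = x.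
Hypothesis r_continuous : forall i x, S i x -> {for x, continuous (r i)}.

Let W : topologicalType := wedge (fun _ : 'I_c => y0).
Let lift i : Y -> W := @wedge_lift _ _ (fun _ : 'I_c => y0) i.
Let i0 : 'I_c := Ordinal c_gt0.

Let Sp i : S i p. Proof. by rewrite -(gp i). Qed.
Let rp i : r i p = y0. Proof. by rewrite -(gp i) gK. Qed.
Let liftE i j : lift i y0 = lift j y0.
Proof. exact: (@wedge_liftE _ _ (fun _ : 'I_c => y0) j y0 i y0). Qed.

(** The end map of [H], factored through the wedge: points outside all the [U i] end at [p] and go
    to the base point, which is common to all copies by [liftE]. *)
Let collapse (x : X) : W :=
  if [pick i | `[< U i x >]] is Some i then lift i (r i (H (x, 1)))
  else lift i0 y0.

Let collapseU i x : U i x -> collapse x = lift i (r i (H (x, 1))).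
Proof.
move=> Uix; rewrite /collapse; case: pickP => [j /asboolP Ujx|/(_ i)].
  by rewrite (SU_eq (US Uix) Ujx).
by move/asboolP.
Qed.

Let collapse0 x : (forall i, ~ U i x) -> collapse x = lift i0 y0.
Proof. by move=> nU; rewrite /collapse; case: pickP => // i /asboolP /nU. Qed.

Let rH_continuous i x : S i (H (x, 1)) ->
  {for x, continuous (fun y => r i (H (y, 1)))}.
Proof.
move=> SH; apply: (@continuous_comp _ _ _ (fun y => H (y, 1)) (r i)).
  apply: (@continuous_comp _ _ _ (fun y : X => (y, 1 : R)) H); last exact: H_continuous.
  by apply: pair_continuous; [exact: cvg_id|exact: cvg_cst].
exact: r_continuous.
Qed.

(** On [U i] a single formula applies. At a point outside all of them, each of these formulas takes
    the base point as value and is continuous, because [H] ends at [p], which lies in every [S i];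
    finitely many neighbourhoods are then intersected. *)
Let collapse_continuous : continuous collapse.
Proof.
move=> x; have [[i Uix]|nU] := pselect (exists i, U i x).
  apply: (@near_continuous _ _ _ (fun y => lift i (r i (H (y, 1))))).
    have : nbhs x (U i) by apply: open_nbhs_nbhs; split.
    by apply: filterS => y; exact: collapseU.
  apply: (@continuous_comp _ _ _ (fun y => r i (H (y, 1))) (lift i)).
    by apply: rH_continuous; apply: HS; exact: US.
  exact: wedge_lift_continuous.
have {}nU i : ~ U i x by move=> Uix; apply: nU; exists i.
rewrite /continuous_at (collapse0 nU) => V.
rewrite (@wedge_point_nbhs _ _ (fun _ : 'I_c => y0) i0) => Vn.
have nV (i : 'I_c) : \forall y \near x, V (lift i (r i (H (y, 1)))).
  have SH : S i (H (x, 1)) by rewrite H1.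
  have := rH_continuous SH; rewrite /prop_for /continuous_at H1// rp.
  move=> /(_ (lift i @^-1` V)).
  by apply; exact: (Vn i).
have := @filter_forall X 'I_c
  (fun i => [set y | V (lift i (r i (H (y, 1))))]) (nbhs x) (nbhs_filter x) nV.
apply: (@filterS X (nbhs x)) => y /= Vy.
have [[i Uiy]|nUy] := pselect (exists i, U i y); first by rewrite (collapseU Uiy).
rewrite collapse0; last by move=> i Uiy; apply: nUy; exists i.
exact: (@nbhs_singleton Y y0 (lift i0 @^-1` V) (Vn i0 I)).
Qed.

(** The composite on [X] is the end map of [H]. For the composite on the wedge, [H] is restricted to
    each [S i] and read through [g i] and [r i]; the pieces glue because [H] fixes [p]. *)
Lemma wedge_homotopy_equiv : homotopy_equiv R X W.
Proof.
pose gw : W -> X := wedge_fun g.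
have gE i j : g i y0 = g j y0 by rewrite !gp.
have gwE i y : gw (lift i y) = g i y.
  exact: (@wedge_lift_funE _ _ (fun=> y0) _ g i y gE).
have liftP (w : W) : exists i y, w = lift i y.
  have : [set: W] w by [].
  by rewrite -(@wedgeTE _ _ (fun _ : 'I_c => y0)) => -[i _ [y _ <-]]; exists i, y.
exists collapse, gw; split.
- exact: collapse_continuous.
- by apply: wedge_fun_continuous.
- apply: (homotopic_swap H_continuous) => // x /=.
  have [[i Uix]|nU] := pselect (exists i, U i x).
    by rewrite (collapseU Uix) gwE rK //; apply: HS; exact: US.
  have {}nU i : ~ U i x by move=> Uix; apply: nU; exists i.
  by rewrite collapse0 // gwE gp H1.
pose K i (s : R) y : W := lift i (r i (H (g i y, s))).
have KE s i j : K i s y0 = K j s y0 by rewrite /K !gp !Hp !rp.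
have KwE s i y : wedge_fun (K^~ s) (lift i y) = K i s y.
  exact: (@wedge_lift_funE _ _ (fun _ : 'I_c => y0) _ (K^~ s) i y (KE s)).
apply: (@homotopic_swap _ _ _ _ _
    (uncurry (fun s => wedge_fun (K^~ s)) \o (fun q : W * R => (q.2, q.1)))).
- move=> q; apply: continuous_comp; first exact: swap_continuous.
  apply: (@wedge_fun_joint_continuous _ _ (fun _ : 'I_c => y0)) => //.
    exact: finite_finset.
  move=> i.
  have -> : uncurry (K i) = fun q => lift i (r i (H (g i q.2, q.1))).
    by apply/funext => -[].
  move=> -[s y].
  apply: (@continuous_comp _ _ _ (fun q => r i (H (g i q.2, q.1))) (lift i));
    last exact: wedge_lift_continuous.
  apply: (@continuous_comp _ _ _ (fun q => H (g i q.2, q.1)) (r i));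
    last by apply: r_continuous; apply: HS.
  apply: (@continuous_comp _ _ _ (fun q => (g i q.2, q.1)) H);
    last exact: H_continuous.
  apply: pair_continuous; last exact: cvg_fst.
  apply: (@continuous_comp _ _ _ snd (g i)); first exact: cvg_snd.
  exact: g_continuous.
- move=> w /=; have [i [y ->]] := liftP w.
  by rewrite KwE /K H0 gK.
- move=> w /=; have [i [y ->]] := liftP w.
  rewrite KwE gwE /K.
  have [[j Ujx]|nU] := pselect (exists j, U j (g i y)).
    by rewrite (collapseU Ujx) (SU_eq (gS i y) Ujx).
  have {}nU j : ~ U j (g i y) by move=> Ujx; apply: nU; exists j.
  by rewrite collapse0 // H1 // rp (liftE i i0).
Qed.

End WedgeEquivalence.

(** * The collapsing flow *)

(** On the left [d] is taken from every term, on the right only once from the sum. The induction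
    also carries the nonnegativity of the partial sums. *)
Lemma sumr_truncate (R : realDomainType) (I : Type) (r : seq I) (P : pred I)
    (F : I -> R) (d : R) :
  0 <= d -> (forall i, P i -> 0 <= F i) ->
  \sum_(i <- r | P i) Num.max 0 (F i - d) <=
  Num.max 0 (\sum_(i <- r | P i) F i - d).
Proof.
move=> d0 F0; suff [] : 0 <= \sum_(i <- r | P i) F i /\
    \sum_(i <- r | P i) Num.max 0 (F i - d) <=
    Num.max 0 (\sum_(i <- r | P i) F i - d) by [].
elim/big_rec2 : _ => [|i y1 y2 Pi [y0 y12]].
  by split=> //; rewrite le_max lexx.
have Fi := F0 i Pi; split; first by rewrite addr_ge0.
move: y12; rewrite /Num.max; case: ltP => ?; case: ltP => ?; case: ltP => ?; lra.
Qed.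

Lemma bigmaxr_attained (R : realDomainType) (I : finType) (P : pred I)
    (F : I -> R) :
  0 < \big[Num.max/0]_(i | P i) F i ->
  exists2 i, P i & \big[Num.max/0]_(i | P i) F i <= F i.
Proof.
(* The maximum starts from the default 0, so the invariant must allow a value [<= 0]; positivity
   then excludes that case. *)
have : (exists2 i, P i & \big[Num.max/0]_(i | P i) F i <= F i) \/
    \big[Num.max/0]_(i | P i) F i <= 0; last first.
  by move=> [//|le0]; rewrite ltNge le0.
elim/big_ind : _ => [|y z [[i Pi yi]|y0] [[j Pj zj]|z0]|i Pi]; first by right.
- by case: (leP y z) => _; left; [exists j|exists i].
- by case: (leP y z) => yz; [right|left; exists i].
- by case: (leP y z) => yz; [left; exists j|right].
- by right; rewrite ge_max y0.
- by left; exists i.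
Qed.

(** * Pushing mass along one row *)

Section Push.
Variables (R : realType) (L k : nat).
Local Notation row := 'I_L.+1.
Local Notation level := 'I_k.+1.
Local Notation M := 'M[R]_(L.+1, k.+1).
Implicit Types (x y : M) (i j : row) (b : level) (s : R) (m : level -> R).

Definition nonneg x := forall i b, 0 <= x i b.

Definition monotone x := forall i b i' b',
  x i b != 0 -> x i' b' != 0 -> (i <= i')%N -> (b <= b')%N.

(** The nonzero points of the cone over the complex. A push may change the total mass, so the flow
    lives here and is normalized only at the end. *)
Definition cone x := [/\ nonneg x, monotone x & exists i b, x i b != 0].

(* Used when m is supported at one level b0: on row j, mass at b0 counts
   positively and mass elsewhere negatively; this signed coordinate is raised by
   s * m b0, and all other rows lose what has crossed zero.  The sums over the
   levels only serve to make the formula continuous everywhere. *)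
Definition push j m s x : M :=
  let excess b := Num.max 0 (s * m b - \sum_(b' | b' != b) x j b') in
  \matrix_(i, b)
    if i == j then Num.max 0 (x j b - s * \sum_(b' | b' != b) m b') + excess b
    else Num.max 0 (x i b - \sum_b' excess b').

(** The second condition on [b] makes the vertex at row [j], level [b] compatible with monotonicity
    once the rest of row [j] has vanished. The third provides mass in another row, so that a push
    cannot reach the zero matrix. *)
Definition pushable j m x :=
  (forall b, 0 <= m b) /\
  forall b, 0 < m b ->
    [/\ forall b', b' != b -> m b' = 0,
        forall i b', x i b' != 0 ->
          ((i < j)%N -> (b' <= b)%N) /\ ((j < i)%N -> (b <= b')%N)
      & exists i b', i != j /\ m b <= x i b'].

Lemma pushE j m s x b0 (e := Num.max 0 (s * m b0 - \sum_(b | b != b0) x j b)) :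
  nonneg x -> 0 <= m b0 -> (forall b, b != b0 -> m b = 0) -> 0 <= s ->
  forall i b, push j m s x i b =
    if i == j then
      if b == b0 then x j b0 + e else Num.max 0 (x j b - s * m b0)
    else Num.max 0 (x i b - e).
Proof.
move=> x0 m0 mb0 s0 i b; rewrite mxE.
have e0 b' : b' != b0 ->
    Num.max 0 (s * m b' - \sum_(b'' | b'' != b') x j b'') = 0.
  move=> b'b0; apply/max_idPl; rewrite mb0 // mulr0 sub0r oppr_le0.
  exact: sumr_ge0.
case: eqP => _; last by rewrite (bigD1 b0) //= [X in _ - (_ + X)]big1 ?addr0.
have [->|bb0] := eqVneq b b0.
  by rewrite big1 // mulr0 subr0 max_r.
rewrite e0 // addr0 (bigD1 b0) 1?eq_sym //= big1 ?addr0 // => b' /andP[_ ?].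
exact: mb0.
Qed.

Lemma push_id j m s x : nonneg x -> (forall b, m b = 0) -> push j m s x = x.
Proof.
move=> x0 m0; apply/matrixP => i b; rewrite mxE.
have e0 b' : Num.max 0 (s * m b' - \sum_(b'' | b'' != b') x j b'') = 0.
  apply/max_idPl; rewrite m0 // mulr0 sub0r oppr_le0.
  exact: sumr_ge0.
rewrite e0 addr0 !big1 // mulr0 !subr0 !max_r //.
by case: eqP => [->|].
Qed.

Lemma push0 j m x : nonneg x -> push j m 0 x = x.
Proof.
move=> x0; rewrite -[RHS](@push_id j (fun=> 0) 0) //; apply/matrixP => i b.
rewrite !mxE !mul0r; case: eqP => _ //.
by congr (Num.max _ (_ - _)); apply: eq_bigr => b' _; rewrite !mul0r.
Qed.

Lemma pushable_cases j m x : pushable j m x ->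
  (forall b, m b = 0) \/
  exists b0, [/\ 0 < m b0, forall b, b != b0 -> m b = 0,
        forall i b', x i b' != 0 ->
          ((i < j)%N -> (b' <= b0)%N) /\ ((j < i)%N -> (b0 <= b')%N)
      & exists i b', i != j /\ m b0 <= x i b'].
Proof.
move=> [m0 mP]; have [[b mb]|nm] := pselect (exists b, 0 < m b).
  by right; exists b; have [] := mP b mb.
left=> b; apply/eqP; rewrite eq_le m0 andbT leNgt; apply/negP => mb.
by apply: nm; exists b.
Qed.

Lemma push_supp j m s x i b : nonneg x -> pushable j m x -> 0 <= s ->
  push j m s x i b != 0 -> x i b != 0 \/ i = j /\ 0 < m b.
Proof.
move=> x0 /pushable_cases[m0|[b0 [mb0 m0 _ _]]] s0.
  by rewrite push_id //; left.
rewrite (pushE j x0 (ltW mb0) m0 s0); case: (i =P j) => [->|_].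
  case: (b =P b0) => [->|_]; first by right.
  move=> h; left; apply: contraNneq h => ->.
  by rewrite max_l // sub0r oppr_le0 mulr_ge0 // ltW.
move=> h; left; apply: contraNneq h => ->.
by rewrite max_l // sub0r oppr_le0 le_max lexx.
Qed.

Lemma push_cone j m s x : cone x -> pushable j m x -> 0 <= s <= 1 ->
  cone (push j m s x).
Proof.
move=> [x0 xm xn] mx /andP[s0 s1].
have [m0|[b0 [mb0 m0 xb0 [i0 [b1 [i0j mb1]]]]]] := pushable_cases mx.
  by rewrite push_id.
have pE := pushE j x0 (ltW mb0) m0 s0.
set y := push j m s x in pE *.
set u := \sum_(b | b != b0) x j b in pE.
set e := Num.max 0 _ in pE.
have u_ge0 : 0 <= u by apply: sumr_ge0.
have xu b : b != b0 -> x j b <= u.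
  by move=> bb0; rewrite /u (bigD1 b) //= lerDl sumr_ge0.
have e0 : 0 <= e by rewrite le_max lexx.
(* A new vertex can only be [(j, b0)], and it appears only when [s * m b0] exceeds the mass of row
   [j] off [b0]; truncation has then emptied those entries. *)
have ysupp i b : y i b != 0 -> x i b != 0 \/
    [/\ i = j, b = b0 & forall b', y j b' != 0 -> b' = b0].
  rewrite pE; case: (i =P j) => [->|_].
    case: (b =P b0) => [-> xe|_ h]; last first.
      left; apply: contraNneq h => ->.
      by rewrite max_l // sub0r oppr_le0 mulr_ge0 // ltW.
    have [sm|sm] := lerP (s * m b0) u.
      by left; move: xe; rewrite /e max_l ?addr0 // subr_le0.
    right; split=> // b'; rewrite pE eqxx; case: (b' =P b0) => // /eqP b'b0.
    by rewrite max_l ?eqxx // subr_le0 (le_trans (xu _ b'b0)) // ltW.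
  by move=> h; left; apply: contraNneq h => ->; rewrite max_l // sub0r oppr_le0.
split.
- move=> i b; rewrite pE; case: eqP => _; last by rewrite le_max lexx.
  by case: eqP => _; [rewrite addr_ge0|rewrite le_max lexx].
- move=> i b i' b' yib yib'.
  case: (ysupp _ _ yib) (ysupp _ _ yib') => [xib|[ij bb0 jb0]]
    [xib'|[ij' bb0' jb0']] ii'.
  + exact: xm ii'.
  + have [ltij|] := ltnP i j; first by have [/(_ ltij)] := xb0 _ _ xib; rewrite bb0'.
    rewrite ij' in ii' * => ji; have {}ji : i = j.
      by apply/val_inj/eqP; rewrite eqn_leq ii'.
    by rewrite bb0' (jb0' b) // -ji.
  + have [ltji|] := ltnP j i'; first by have [_ /(_ ltji)] := xb0 _ _ xib'; rewrite bb0.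
    rewrite ij in ii' * => ji; have {}ji : i' = j.
      by apply/val_inj/eqP; rewrite eqn_leq ji.
    by rewrite bb0 (jb0 b') // -ji.
  + by rewrite bb0 bb0'.
(* If all entries were zero, [e] would vanish, and the entry at [(i0, b1)], which is at least
   [m b0], would have survived. *)
- have [//|y0] := pselect (exists i b, y i b != 0).
  have {}y0 i b : y i b = 0.
    by apply/eqP; apply: contra_notT y0 => ?; exists i, b.
  have := y0 i0 b1; have := y0 j b0; rewrite !pE !eqxx (negbTE i0j).
  have := x0 j b0; have : s * m b0 <= m b0 by rewrite ler_piMl // ltW.
  rewrite /e /Num.max; case: ltP; case: ltP; lra.
Qed.

End Push.

(** * Strict sequences and the composite of the pushes *)

Section Flow.
Variables (R : realType) (L k : nat).
Local Notation row := 'I_L.+1.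
Local Notation level := 'I_k.+1.
Local Notation M := 'M[R]_(L.+1, k.+1).
Implicit Types (x y : M) (i : row) (j : nat) (b : level) (s : R).

(* If x carries a strict sequence 0 < c 0 < ... < c j = b on the rows 0, ..., j,
   this is its least weight; it is 0 otherwise.  The support of a point of the
   complex has at most one level per row, so the sum has at most one term. *)
Fixpoint chain x j : level -> R :=
  if j is j'.+1 then
    fun b => Num.min (x (inord j) b) (\sum_(b' : level | (b' < b)%N) chain x j' b')
  else fun b => if b == ord0 then 0 else x ord0 b.

(* The amount pushed on row j.  There is no shorter sequence on row 0: the maximum
   is what empties every other row. *)
Definition prechain x j : level -> R :=
  if j is j'.+1 then chain x j' else
  fun b => if b == ord0 then
             \big[Num.max/0]_(p : row * level | p.1 != ord0) x p.1 p.2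
           else 0.

(** Rows are treated from [j - 1] down to 0, each [prechain] being computed from the matrix left by
    the previous push. All pushes share the time [s], so a single parameter runs all the
    collapses. *)
Fixpoint flow s j x : M :=
  if j is j'.+1 then flow s j' (push (inord j') (prechain x j') s x) else x.

Lemma inord0 : inord 0 = ord0 :> row.
Proof. by apply: val_inj; rewrite /= inordK. Qed.

Lemma chain_ge0 x j b : nonneg x -> 0 <= chain x j b.
Proof.
move=> x0; elim: j b => [|j IHj] b /=; first by case: eqP.
by rewrite le_min x0 sumr_ge0.
Qed.

Lemma chain_le x j b : nonneg x -> chain x j b <= x (inord j) b.
Proof.
move=> x0; case: j => [|j] /=; last by rewrite ge_min lexx.
by rewrite inord0; case: eqP.
Qed.

Lemma chain_neq0 x j b : nonneg x -> 0 < chain x j b -> x (inord j) b != 0.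
Proof. by move=> x0 /lt_le_trans/(_ (chain_le j b x0)); rewrite lt0r => /andP[]. Qed.

Lemma chain_uniq x j b b' : nonneg x -> monotone x ->
  0 < chain x j b -> b' != b -> chain x j b' = 0.
Proof.
move=> x0 xm /(chain_neq0 x0) xb b'b; apply/eqP; rewrite eq_le chain_ge0 //.
rewrite andbT leNgt; apply/negP => /(chain_neq0 x0) xb'.
move/eqP: b'b; apply; apply/val_inj/eqP; rewrite eqn_leq.
by rewrite (xm _ _ _ _ xb xb' (leqnn _)) (xm _ _ _ _ xb' xb (leqnn _)).
Qed.

(** On row 0 the level is 0, the lowest one, and the maximum is attained in another row. On row
    [j + 1] the level is one occupied by [x] on row [j], so monotonicity gives compatibility and row
    [j] supplies the required mass. *)
Lemma prechain_pushable x j : cone x -> (j <= L)%N ->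
  pushable (inord j) (prechain x j) x.
Proof.
move=> [x0 xm _]; case: j => [_|j jL] /=.
  rewrite inord0; split=> [b|b] /=.
    case: eqP => // _; elim/big_ind : _ => // y z y0 z0.
    by rewrite le_max y0.
  case: eqP => [->|_]; last by rewrite ltxx.
  move=> mx0; split=> [b' /negbTE -> //|i b' _|]; first by rewrite ltn0 leq0n.
  by have [[i b'] i0 le] := bigmaxr_attained mx0; exists i, b'.
split=> [b|b cb]; first exact: chain_ge0.
have xb := chain_neq0 x0 cb; have jL' : (j < L.+1)%N by exact: ltnW.
split=> [b'|i b' xb'|]; first exact: chain_uniq.
  rewrite inordK //; split=> [ij|ji].
    by apply: xm xb' xb _; rewrite inordK // -ltnS.
  by apply: xm xb xb' _; rewrite inordK // ltnW // ltnW.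
exists (inord j), b; split; last exact: chain_le.
by rewrite -val_eqE /= !inordK // neq_ltn leqnn.
Qed.

Lemma flow_cone s j x : cone x -> 0 <= s <= 1 -> (j <= L.+1)%N ->
  cone (flow s j x).
Proof.
elim: j x => [//|j IHj] x xC s01 jL /=.
apply: IHj => //; last exact: ltnW.
by apply: push_cone => //; exact: prechain_pushable.
Qed.

Lemma flow0 j x : nonneg x -> flow 0 j x = x.
Proof. by elim: j x => [//|j IHj] x x0 /=; rewrite push0 ?IHj. Qed.

(** Serves for a push that takes [d] from all rows up to [j]. Truncation commutes with the minimum
    and passes through the sum by [sumr_truncate]. *)
Lemma chain_truncate x y d j b : nonneg x -> 0 <= d -> (j <= L)%N ->
  (forall i b', (i <= j)%N -> y i b' = Num.max 0 (x i b' - d)) ->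
  chain y j b <= Num.max 0 (chain x j b - d).
Proof.
move=> x0 d0; elim: j b => [|j IHj] b jL yE /=.
  by case: eqP => _; [rewrite le_max lexx|rewrite yE].
rewrite yE ?inordK //.
have : \sum_(b' : level | (b' < b)%N) chain y j b' <=
    Num.max 0 (\sum_(b' : level | (b' < b)%N) chain x j b' - d).
  apply: le_trans (sumr_truncate (index_enum level) d0
    (fun b' (_ : (b' < b)%N) => chain_ge0 j b' x0)).
  apply: ler_sum => b' _; apply: IHj => [|i b'' ij]; first exact: ltnW.
  by apply: yE; exact: leqW.
move=> sumle; rewrite ge_min.
by case: (leP (x (inord j.+1) b)) => _; rewrite ?lexx // sumle orbT.
Qed.

(** If no strict sequence reaches row [j + 1], the complete push on that row destroys all those
    reaching row [j]. When row 0 is reached, its mass is at level 0 only, and the last push takes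
    from all other rows their maximal entry. *)
Lemma flow_end j x : cone x -> (j <= L)%N -> (forall b, chain x j b = 0) ->
  forall i b, flow 1 j.+1 x i b != 0 -> i = ord0 /\ b = ord0.
Proof.
elim: j x => [|j IHj] x xC jL c0.
  have [x0 xm _] := xC => i b.
  rewrite -[flow _ _ _]/(push (inord 0) (prechain x 0) 1 x) inord0.
  set m := prechain x 0; rewrite (@pushE _ _ _ _ _ _ _ ord0) //; last 2 first.
  - exact: (prechain_pushable xC (leq0n L)).1.
  - by move=> b' /negbTE b'0; rewrite /m /= b'0.
  have row0 b' : b' != ord0 -> x ord0 b' = 0.
    by move=> b'0; have := c0 b'; rewrite /= (negbTE b'0).
  have mxi i' b' : i' != ord0 -> x i' b' <= m ord0.
    move=> i'0; rewrite /m /= (bigD1 (i', b')) //=.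
    by rewrite le_max lexx.
  rewrite mul1r big1 => [|b' /row0 //]; rewrite subr0.
  have m0 : 0 <= m ord0 by exact: (prechain_pushable xC (leq0n L)).1.
  rewrite (max_r m0); case: (i =P ord0) => [->|/eqP i0].
    case: (b =P ord0) => [-> //|/eqP b0].
    by rewrite row0 // sub0r max_l ?eqxx // oppr_le0.
  by rewrite max_l ?eqxx // subr_le0 mxi.
have [x0 xm _] := xC.
have pC : pushable (inord j.+1) (prechain x j.+1) x by exact: prechain_pushable.
rewrite -/(flow 1 j.+1 (push (inord j.+1) (prechain x j.+1) 1 x)).
have s1 : 0 <= (1 : R) <= 1 by rewrite ler01 lexx.
apply: IHj; [exact: push_cone|exact: ltnW|].
have [m0|[b0 [mb0 m0 _ _]]] := pushable_cases pC; first by rewrite push_id.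
(* Mass of row [j + 1] above [b0] would prolong the strict sequence, and mass below [b0] would
   violate monotonicity. Hence the full amount [prechain x j.+1 b0] is taken from the other rows. *)
have u0 : \sum_(b | b != b0) x (inord j.+1) b = 0.
  apply: big1 => b bb0; apply/eqP; apply: contraT => xb.
  have [ltb|leb] := ltnP b0 b.
    have := c0 b; rewrite /= => /eqP; rewrite eq_le => /andP[+ _].
    rewrite ge_min leNgt lt0r xb x0 /= leNgt (lt_le_trans mb0) //.
    by rewrite (bigD1 b0) //= lerDl sumr_ge0 // => b' _; exact: chain_ge0.
  move/eqP: bb0; case; apply/val_inj/eqP; rewrite eqn_leq leb /=.
  apply: xm (chain_neq0 x0 mb0) xb _.
  by rewrite !inordK // ltnW // ltnS ltnW.
have pE := pushE (inord j.+1) x0 (ltW mb0) m0 ler01.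
rewrite u0 mul1r subr0 (max_r (ltW mb0)) in pE.
move=> b; set y := push _ _ _ _ in pE *.
have yC : cone y by exact: push_cone.
have y0 : nonneg y by case: yC.
apply/eqP; rewrite eq_le chain_ge0 // andbT.
apply: le_trans
  (@chain_truncate x y (prechain x j.+1 b0) j b x0 (ltW mb0) (ltnW jL) _) _.
  move=> i b' ij; rewrite pE -val_eqE /= inordK //.
  by rewrite ltn_eqF.
have [->|bb0] := eqVneq b b0; first by rewrite subrr maxxx.
by have /= -> := m0 b bb0; rewrite ge_max lexx sub0r oppr_le0 ltW.
Qed.

Definition strict (c : nat -> level) j :=
  (0 < c 0)%N /\ forall i : nat, (i < j)%N -> (c i < c i.+1)%N.

Definition prev_level (c : nat -> level) j : level := if j is j'.+1 then c j' else ord0.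

(** The support condition for the cone over the cross-polytope [S_c]. *)
Definition cross (c : nat -> level) x :=
  forall i b, x i b != 0 -> b = prev_level c i \/ b = c i.

Lemma strict_lt c (i i' : nat) : strict c L -> (i < i')%N -> (i' <= L)%N ->
  (c i < c i')%N.
Proof.
move=> [_ cS]; elim: i' => // i' IHi'; rewrite ltnS leq_eqVlt.
move=> /predU1P[->|ii'] i'L; first exact: cS.
by apply: ltn_trans (IHi' ii' (ltnW i'L)) (cS _ i'L).
Qed.

Lemma prev_level_lt c (i : nat) : strict c L -> (i <= L)%N -> (prev_level c i < c i)%N.
Proof. by case: i => [|i] [c0 cS] iL //=; exact: cS. Qed.

Lemma chain_strict x j b : nonneg x -> (j <= L)%N -> 0 < chain x j b ->
  exists c, [/\ strict c j, c j = b
    & forall i : nat, (i <= j)%N -> 0 < x (inord i) (c i)].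
Proof.
move=> x0; elim: j b => [|j IHj] b jL cb.
  exists (fun=> b); split=> // [|[|//] _].
    split=> //; move: cb => /=; case: eqP; rewrite ?ltxx // => /eqP.
    by rewrite -val_eqE lt0n.
  exact: lt_le_trans cb (chain_le 0 b x0).
move: (cb); rewrite /= lt_min => /andP[xb].
rewrite lt0r psumr_neq0 => [/andP[/hasP[b' _ /andP[b'b cb']] _]|b' _];
  last exact: chain_ge0.
have [c [[c0 cS] cj xc]] := IHj b' (ltnW jL) cb'.
exists (fun i : nat => if (i <= j)%N then c i else b); split.
- split=> // i; rewrite ltnS => ij; rewrite ij.
  have [ij'|ij'] := ltnP i j; first exact: cS.
  have -> : i = j by apply/eqP; rewrite eqn_leq ij.
  by rewrite cj.
- by rewrite ltnn.
- move=> i; rewrite leq_eqVlt => /predU1P[->|]; first by rewrite ltnn.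
  by rewrite ltnS => ij; rewrite ij; exact: xc.
Qed.

(** On row [j + 1] the only alternative to [c j.+1] is [c j]; by induction the sequence is already
    at [c j] on row [j], and it must strictly increase. *)
Lemma cross_chain c x j b : nonneg x -> cross c x -> (j <= L)%N ->
  0 < chain x j b -> b = c j.
Proof.
move=> x0 cx; elim: j b => [|j IHj] b jL cb.
  have := chain_neq0 x0 cb; rewrite inord0 => /cx[] //= b0.
  by move: cb; rewrite /= b0 eqxx ltxx.
have := chain_neq0 x0 cb => /cx; rewrite inordK //= => -[bc|//].
move: cb; rewrite /= lt_min => /andP[_].
rewrite lt0r psumr_neq0 => [/andP[/hasP[b' _ /andP[b'b cb']] _]|b' _];
  last exact: chain_ge0.
by move: b'b; rewrite (IHj b' (ltnW jL) cb') bc ltnn.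
Qed.

(** The only vertex that a push can add on row [j] has level [prev_level c j]: level 0 on row 0, and
    the level given by [cross_chain] on later rows. *)
Lemma flow_cross c s j x : cone x -> cross c x -> 0 <= s <= 1 ->
  (j <= L.+1)%N -> cross c (flow s j x).
Proof.
elim: j x => [//|j IHj] x xC cx s01 jL /=.
have pC := prechain_pushable xC jL.
have [x0 _ _] := xC; have /andP[s0 _] := s01.
apply: IHj => //; [exact: push_cone| |exact: ltnW].
move=> i b /(push_supp x0 pC s0) [|[-> mb]]; first exact: cx.
rewrite inordK //; left; move: mb; case: j {pC} jL => [|j] jL /=.
  by case: eqP => [->|]; rewrite ?ltxx.
by apply: cross_chain => //; rewrite ltnW.
Qed.

End Flow.

(** * Continuity of the flow *)

Section ContinuityAt.
Variables (R : realType) (T : topologicalType).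
Implicit Types (f g : T -> R) (t : T).

Lemma max_continuous_at f g t : {for t, continuous f} -> {for t, continuous g} ->
  {for t, continuous (fun u => Num.max (f u) (g u))}.
Proof. exact: continuous_max. Qed.

Lemma min_continuous_at f g t : {for t, continuous f} -> {for t, continuous g} ->
  {for t, continuous (fun u => Num.min (f u) (g u))}.
Proof. exact: continuous_min. Qed.

Lemma sum_continuous_at (I : Type) (r : seq I) (P : pred I) (F : I -> T -> R) t :
  (forall i, P i -> {for t, continuous (F i)}) ->
  {for t, continuous (fun u => \sum_(i <- r | P i) F i u)}.
Proof. by move=> cF; apply: cvg_big => //; exact: add_continuous. Qed.

Lemma bigmax_continuous_at (I : Type) (r : seq I) (P : pred I) (F : I -> T -> R) t :
  (forall i, P i -> {for t, continuous (F i)}) ->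
  {for t, continuous (fun u => \big[Num.max/0]_(i <- r | P i) F i u)}.
Proof.
move=> cF; apply: cvg_big => // q.
by apply: (@continuous_max R (R * R)%type fst snd q); [exact: cvg_fst|exact: cvg_snd].
Qed.

Lemma matrix_continuous_at m n (f : T -> 'M[R]_(m, n)) t :
  (forall i j, {for t, continuous (fun u => f u i j)}) -> {for t, continuous f}.
Proof.
move=> cf V [P Pn PV].
have nP : \forall u \near t, forall i j, P i j (f u i j).
  apply: filter_forall => i; apply: filter_forall => j.
  exact: cf (Pn i j).
by apply: filterS nP => u Pu; exact: PV.
Qed.

Variables (L k : nat).
Local Notation row := 'I_L.+1.
Local Notation level := 'I_k.+1.
Local Notation M := 'M[R]_(L.+1, k.+1).

Definition entries_continuous_at (x : T -> M) t :=
  forall i b, {for t, continuous (fun u => x u i b)}.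

Lemma push_continuous_at (j : row) (m : T -> level -> R) (s : T -> R)
    (x : T -> M) t :
  (forall b, {for t, continuous (fun u => m u b)}) -> {for t, continuous s} ->
  entries_continuous_at x t ->
  entries_continuous_at (fun u => push j (m u) (s u) (x u)) t.
Proof.
move=> cm cs cx i b; pose e u b0 :=
  Num.max 0 (s u * m u b0 - \sum_(b' | b' != b0) x u j b').
have ce b0 : {for t, continuous (e ^~ b0)}.
  apply: max_continuous_at; first exact: cvg_cst.
  apply: cvgB; first by apply: cvgM => //; exact: cm.
  by apply: sum_continuous_at => b' _; exact: cx.
rewrite (_ : (fun u => _) = fun u =>
    if i == j then Num.max 0 (x u j b - s u * \sum_(b' | b' != b) m u b') + e u b
    else Num.max 0 (x u i b - \sum_b' e u b')); last first.
  by apply/funext => u; rewrite mxE.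
case: eqP => _.
  apply: cvgD; last exact: ce.
  apply: max_continuous_at; first exact: cvg_cst.
  apply: cvgB; first exact: cx.
  by apply: cvgM => //; apply: sum_continuous_at => b' _; exact: cm.
apply: max_continuous_at; first exact: cvg_cst.
apply: cvgB; first exact: cx.
by apply: sum_continuous_at => b' _; exact: ce.
Qed.

Lemma chain_continuous_at (x : T -> M) t j b : entries_continuous_at x t ->
  {for t, continuous (fun u => chain (x u) j b)}.
Proof.
move=> cx; elim: j b => [|j IHj] b /=.
  by case: eqP => _; [exact: cvg_cst|exact: cx].
apply: min_continuous_at; first exact: cx.
by apply: sum_continuous_at => b' _; exact: IHj.
Qed.

Lemma prechain_continuous_at (x : T -> M) t j b : entries_continuous_at x t ->
  {for t, continuous (fun u => prechain (x u) j b)}.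
Proof.
move=> cx; case: j => [|j] /=; last exact: chain_continuous_at.
case: eqP => _; last exact: cvg_cst.
by apply: bigmax_continuous_at => p _; exact: cx.
Qed.

Lemma flow_continuous_at (s : T -> R) (x : T -> M) t j :
  {for t, continuous s} -> entries_continuous_at x t ->
  entries_continuous_at (fun u => flow (s u) j (x u)) t.
Proof.
move=> cs; elim: j x => [//|j IHj] x cx /=.
apply: (IHj (fun u => push (inord j) (prechain (x u) j) (s u) (x u))).
by apply: push_continuous_at => // b; exact: prechain_continuous_at.
Qed.

End ContinuityAt.

(** * Counting the strict sequences of levels *)

Lemma strict_enum (L k : nat) :
  exists cs : 'I_'C(k, L.+1) -> nat -> 'I_k.+1,
    [/\ forall i, strict (cs i) L,
        forall i i', (forall j : 'I_L.+1, cs i j = cs i' j) -> i = i'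
      & forall c, strict c L -> exists i, forall j : 'I_L.+1, cs i j = c j].
Proof.
(* Lowering every level by 1 turns a strict sequence into an increasing tuple in ['I_k], and [lev]
   shifts back; these tuples are counted by ['C(k, L.+1)]. *)
pose Om := [set t : L.+1.-tuple 'I_k | sorted ltn [seq \val i | i <- t]]%SET.
have cardOm : #|Om| = 'C(k, L.+1) by rewrite card_ltn_sorted_tuples.
pose tup i : L.+1.-tuple 'I_k := enum_val (cast_ord (esym cardOm) i).
have tupOm i : tup i \in Om by exact: enum_valP.
pose lev (t : L.+1.-tuple 'I_k) (j : nat) : 'I_k.+1 :=
  inord (nth 0 [seq \val i | i <- t] j).+1.
have levE t (j : 'I_L.+1) : lev t j = (tnth t j).+1 :> nat.
  rewrite /lev (nth_map (tnth t j)) ?size_tuple // -tnth_nth.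
  by rewrite inordK // ltnS ltn_ord.
exists (fun i => lev (tup i)); split.
- move=> i; have := tupOm i; rewrite inE => tS; split.
    by rewrite (levE _ ord0).
  move=> j jL; rewrite (levE _ (Ordinal (ltnW (jL : j.+1 < L.+1)%N))).
  rewrite (levE _ (Ordinal (jL : j.+1 < L.+1)%N)) ltnS.
  have /(sortedP 0)/(_ j) := tS; rewrite size_map size_tuple => /(_ jL).
  set t := tup i; pose x0 := tnth t ord0.
  rewrite !(nth_map x0) ?size_tuple //; last exact: ltnW.
  by rewrite !(tnth_nth x0).
- move=> i i' ii'; suff tt' : tup i = tup i'.
    by apply/(@cast_ord_inj _ _ (esym cardOm))/enum_val_inj.
  apply: eq_from_tnth => j; apply: val_inj.
  by have := congr1 val (ii' j); rewrite /= !levE => -[].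
- move=> c cS.
  have c_gt0 (j : 'I_L.+1) : (0 < c j)%N.
    by apply: leq_ltn_trans (prev_level_lt cS _); rewrite // -ltnS ltn_ord.
  have ck (j : 'I_L.+1) : ((c j).-1 < k)%N.
    by rewrite prednK // -ltnS ltn_ord.
  pose t := [tuple Ordinal (ck j) | j < L.+1].
  have levt (j : 'I_L.+1) : lev t j = c j.
    by apply: val_inj; rewrite /= levE tnth_mktuple /= prednK.
  have tOm : t \in Om.
    rewrite inE; apply/(sortedP 0) => j; rewrite size_map size_tuple => jL.
    rewrite /ltn /= -ltnS.
    have nthE (j' : 'I_L.+1) : (nth 0 [seq \val i | i <- t] j').+1 = c j'.
      rewrite -levt levE (nth_map (tnth t j')) ?size_tuple //.
      by rewrite -tnth_nth.
    rewrite (nthE (Ordinal (ltnW jL))) (nthE (Ordinal jL)) /=.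
    by case: cS => _; exact.
  exists (cast_ord cardOm (enum_rank_in tOm t)) => j.
  by rewrite /tup cast_ordK enum_rankK_in.
Qed.

(** * The realization in matrix coordinates *)

Section StaircaseComplex.
Variables (R : realType) (L k : nat).
Local Notation row := 'I_L.+1.
Local Notation level := 'I_k.+1.
Local Notation M := 'M[R]_(L.+1, k.+1).
Local Notation sphere := (sphere R L).
Implicit Types (x y : M) (v : 'rV[R]_L.+1) (c : nat -> level).

Definition mass x := \sum_i \sum_b x i b.

Definition normalize x : M := (mass x)^-1 *: x.

(** The realization of the complex, with barycentric coordinates arranged by row and level. *)
Definition staircase_set : set M := [set x | [/\ nonneg x, mass x = 1 & monotone x]].

Lemma nonneg_mass_gt0 x : nonneg x -> (exists i b, x i b != 0) -> 0 < mass x.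
Proof.
move=> x0 [i [b xb]]; rewrite /mass (bigD1 i) //= (bigD1 b) //= -addrA.
rewrite ltr_wpDr ?lt0r ?xb ?x0 // addr_ge0 //; first exact: sumr_ge0.
by apply: sumr_ge0 => i' _; exact: sumr_ge0.
Qed.

Lemma staircase_set_cone x : staircase_set x -> cone x.
Proof.
move=> [x0 x1 xm]; split=> //; have [//|xn] := pselect (exists i b, x i b != 0).
suff : mass x = 0 by rewrite x1 => /eqP; rewrite oner_eq0.
rewrite /mass big1 // => i _; rewrite big1 // => b _.
by apply/eqP; apply: contra_notT xn => xb; exists i, b.
Qed.

Lemma normalizeZ (a : R) x : 0 < a -> normalize (a *: x) = normalize x.
Proof.
move=> a0; rewrite /normalize.
have -> : mass (a *: x) = a * mass x.
  rewrite /mass mulr_sumr; apply: eq_bigr => i _; rewrite mulr_sumr.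
  by apply: eq_bigr => b _; rewrite mxE.
by rewrite scalerA invfM mulrAC mulVf ?mul1r // gt_eqF.
Qed.

Lemma normalize_id x : mass x = 1 -> normalize x = x.
Proof. by rewrite /normalize => ->; rewrite invr1 scale1r. Qed.

Lemma normalize_neq0 x i b : normalize x i b != 0 -> x i b != 0.
Proof. by rewrite mxE; apply: contraNneq => ->; rewrite mulr0. Qed.

Lemma normalize_staircase x : cone x -> staircase_set (normalize x).
Proof.
move=> [x0 xm xn]; have s0 := nonneg_mass_gt0 x0 xn; split.
- by move=> i b; rewrite mxE mulr_ge0 // invr_ge0 ltW.
- rewrite {1}/mass -[RHS](mulVf (negbT (gt_eqF s0))) [in RHS]/mass mulr_sumr.
  apply: eq_bigr => i _; rewrite mulr_sumr.
  by apply: eq_bigr => b _; rewrite mxE.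
- by move=> i b i' b' /normalize_neq0 xb /normalize_neq0 xb'; exact: xm xb xb'.
Qed.

Definition staircase_space : topologicalType := set_type staircase_set.
Local Notation X := staircase_space.
Implicit Types p : X.

Lemma apex_staircase : staircase_set (delta_mx ord0 ord0).
Proof.
split.
- by move=> i b; rewrite mxE ler0n.
- rewrite /mass (bigD1 ord0) //= (bigD1 ord0) //= mxE !eqxx !big1 ?addr0 // => i.
    by move=> /negbTE i0; rewrite big1 // => b _; rewrite mxE i0.
  by move=> /negbTE i0; rewrite mxE i0 andbF.
- move=> i b i' b'; rewrite !mxE.
  by case: (b =P ord0) => [-> //|_]; rewrite andbF eqxx.
Qed.

Definition apex : X :=
  exist (fun x => x \in staircase_set) _ (mem_set apex_staircase).

Definition to_space x : X := insubd apex x.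

Lemma to_spaceK x : staircase_set x -> set_val (to_space x) = x.
Proof. by move=> xX; apply: insubdK; exact: mem_set. Qed.

Lemma to_space_val (p : X) : to_space (set_val p) = p.
Proof. exact: valKd. Qed.

Lemma space_staircase (p : X) : staircase_set (set_val p).
Proof. exact: set_mem (valP p). Qed.

Lemma space_cone (p : X) : cone (set_val p).
Proof. exact: staircase_set_cone (space_staircase p). Qed.

Lemma normalize_continuous_at (T : topologicalType) (x : T -> M) (t : T) :
  entries_continuous_at x t -> mass (x t) != 0 ->
  entries_continuous_at (fun u => normalize (x u)) t.
Proof.
move=> cx xt i b; rewrite (_ : (fun u => _) = fun u => (mass (x u))^-1 * x u i b).
  apply: cvgM; last exact: cx.
  apply: cvgV => //; apply: sum_continuous_at => i' _.
  by apply: sum_continuous_at => b' _; exact: cx.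
by apply/funext => u; rewrite mxE.
Qed.

Lemma to_space_continuous_at (T : topologicalType) (x : T -> M) (t : T) :
  (forall u, cone (x u)) -> entries_continuous_at x t ->
  {for t, continuous (fun u => to_space (normalize (x u)))}.
Proof.
move=> xC cx; apply: set_type_continuous_at.
rewrite (_ : _ \o _ = fun u => normalize (x u)); last first.
  by apply/funext => u /=; rewrite to_spaceK //; exact: normalize_staircase.
apply: matrix_continuous_at; apply: normalize_continuous_at => //.
by have [x0 _ xn] := xC t; rewrite gt_eqF // nonneg_mass_gt0.
Qed.

(* Clamping the time makes the homotopy continuous on X * R, not only on X * [0, 1]. *)
Definition clamp (s : R) := Num.max 0 (Num.min s 1).

Lemma clamp01 s : 0 <= clamp s <= 1.
Proof. by rewrite /clamp le_max lexx ge_max ler01 ge_min lexx orbT. Qed.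

Lemma clamp_id s : 0 <= s <= 1 -> clamp s = s.
Proof. by move=> /andP[s0 s1]; rewrite /clamp min_l // max_r. Qed.

Lemma clamp_continuous : continuous clamp.
Proof.
move=> s.
apply: (@max_continuous_at R R (fun=> 0) (fun u => Num.min u 1) s).
  exact: cvg_cst.
by apply: (@min_continuous_at R R id (fun=> 1) s); [exact: cvg_id|exact: cvg_cst].
Qed.

Definition space_flow (q : X * R) : X :=
  to_space (normalize (flow (clamp q.2) L.+1 (set_val q.1))).

Lemma flow_space_cone p s : cone (flow (clamp s) L.+1 (set_val p)).
Proof. exact: flow_cone (space_cone p) (clamp01 s) (leqnn _). Qed.

Lemma set_val_space_flow p s : set_val (space_flow (p, s)) =
  normalize (flow (clamp s) L.+1 (set_val p)).
Proof. exact: to_spaceK (normalize_staircase (flow_space_cone p s)). Qed.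

Lemma space_flow_continuous : continuous space_flow.
Proof.
move=> q; apply: (@to_space_continuous_at _
    (fun u : X * R => flow (clamp u.2) L.+1 (set_val u.1)) q) => [u|].
  exact: flow_space_cone.
apply: (@flow_continuous_at _ _ _ _ (clamp \o snd)
    (fun u : X * R => set_val u.1)).
  by apply: (@continuous_comp _ _ _ snd clamp);
    [exact: cvg_snd|exact: clamp_continuous].
move=> i b; apply: (@continuous_comp _ _ _ fst (fun p : X => set_val p i b)).
  exact: cvg_fst.
apply: (@continuous_comp _ _ _ (set_val : X -> M) (fun x => x i b)).
  exact: set_val_continuous.
exact: coord_continuous.
Qed.

Lemma space_flow0 p : space_flow (p, 0) = p.
Proof.
have [p0 p1 _] := space_staircase p.
apply: val_inj; rewrite -[LHS]/(set_val _) set_val_space_flow clamp_id.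
  by rewrite flow0 // normalize_id.
by rewrite lexx ler01.
Qed.

Lemma apexP p : (forall i b, set_val p i b != 0 -> i = ord0 /\ b = ord0) ->
  p = apex.
Proof.
move=> p0; apply: val_inj; apply/matrixP => i b.
have [_ p1 _] := space_staircase p.
rewrite /= mxE; case: (altP andP) => [[/eqP-> /eqP->]|ib].
  rewrite -[RHS]p1 /mass (bigD1 ord0) //= (bigD1 ord0) //= !big1 ?addr0 // => i'.
    move=> i'0; rewrite big1 // => b' _; apply/eqP; apply: contraNT i'0.
    by move=> /p0[->].
  by move=> b'0; apply/eqP; apply: contraNT b'0 => /p0[_ ->].
by apply/eqP; apply: contraNT ib => /p0[-> ->].
Qed.

Lemma space_flow1 p : (forall b, chain (set_val p) L b = 0) ->
  space_flow (p, 1) = apex.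
Proof.
move=> c0; apply: apexP => i b; rewrite set_val_space_flow clamp_id; last first.
  by rewrite ler01 lexx.
by move=> /normalize_neq0; apply: flow_end => //; exact: space_cone.
Qed.

Lemma chain_ord0 x j : nonneg x -> chain x j ord0 = 0.
Proof. by move=> x0; case: j => [//|j] /=; rewrite big1 // min_r. Qed.

(** Strict sequences avoid level 0, and the apex has no mass outside row 0; hence every push fixes
    it. *)
Lemma prechain_apex j b : prechain (set_val apex) j b = 0.
Proof.
have [x0 _ _] := space_staircase apex.
case: j => [|j] /=.
  case: eqP => // _; apply/eqP; rewrite eq_le; apply/andP; split.
    apply/bigmax_leP; split=> // -[i b'] /= i0.
    by rewrite mxE (negbTE i0).
  by apply: bigmax_ge_id.
apply/eqP; rewrite eq_le chain_ge0 // andbT leNgt; apply/negP => cb.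
have := chain_neq0 x0 cb; rewrite mxE; case: (b =P ord0) => [b0|_].
  by move: cb; rewrite b0 chain_ord0 ?ltxx.
by rewrite andbF eqxx.
Qed.

Lemma space_flow_apex s : space_flow (apex, s) = apex.
Proof.
apply: val_inj; rewrite -[LHS]/(set_val _) set_val_space_flow.
have [x0 x1 _] := space_staircase apex.
suff -> : flow (clamp s) L.+1 (set_val apex) = set_val apex.
  exact: normalize_id.
suff : forall j, flow (clamp s) j (set_val apex) = set_val apex by exact.
by elim=> //= j IHj; rewrite push_id //; exact: prechain_apex.
Qed.

(** * Radial projection and signed coordinates on the cross-polytopes *)

Definition normalize2 v : 'rV[R]_L.+1 := (Num.sqrt (\sum_i v ord0 i ^+ 2))^-1 *: v.

Lemma sum_sqr_gt0 v : v != 0 -> 0 < \sum_i v ord0 i ^+ 2.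
Proof.
move=> v0; rewrite lt0r sumr_ge0 ?andbT => [|i _]; last exact: sqr_ge0.
apply: contraNneq v0 => /eqP; rewrite psumr_eq0 => [/allP v0|i _]; last exact: sqr_ge0.
apply/eqP/rowP => i; rewrite mxE; apply/eqP; rewrite -sqrf_eq0.
by apply: v0; rewrite mem_index_enum.
Qed.

Lemma sum_sqrZ (a : R) v :
  \sum_i (a *: v) ord0 i ^+ 2 = a ^+ 2 * \sum_i v ord0 i ^+ 2.
Proof. by rewrite mulr_sumr; apply: eq_bigr => i _; rewrite mxE exprMn. Qed.

Lemma sum_sqr_continuous_at (T : topologicalType) (v : T -> 'rV[R]_L.+1) (t : T) :
  (forall i, {for t, continuous (fun u => v u ord0 i)}) ->
  {for t, continuous (fun u => \sum_i v u ord0 i ^+ 2)}.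
Proof.
move=> cv; apply: sum_continuous_at => i _.
exact: (cvgM (cv i) (cv i)).
Qed.

Lemma near_neq0_row (T : topologicalType) (v : T -> 'rV[R]_L.+1) (t : T) :
  (forall i, {for t, continuous (fun u => v u ord0 i)}) -> v t != 0 ->
  \forall u \near t, v u != 0.
Proof.
move=> cv v0; have : \forall u \near t, \sum_i v u ord0 i ^+ 2 != 0.
  by apply: cvgr_neq0 (sum_sqr_continuous_at cv) _; rewrite gt_eqF // sum_sqr_gt0.
apply: filterS => u; apply: contraNneq => ->.
by rewrite big1 // => i _; rewrite mxE expr0n.
Qed.

Lemma normalize2_continuous_at (T : topologicalType) (v : T -> 'rV[R]_L.+1)
    (t : T) (j : row) :
  (forall i, {for t, continuous (fun u => v u ord0 i)}) -> v t != 0 ->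
  {for t, continuous (fun u => normalize2 (v u) ord0 j)}.
Proof.
move=> cv v0; rewrite (_ : (fun u => _) = fun u =>
  (Num.sqrt (\sum_i v u ord0 i ^+ 2))^-1 * v u ord0 j).
  apply: cvgM; last exact: cv.
  apply: cvgV; first by rewrite gt_eqF // sqrtr_gt0 sum_sqr_gt0.
  apply: (@continuous_comp _ _ _ (fun u => \sum_i v u ord0 i ^+ 2) Num.sqrt).
    exact: sum_sqr_continuous_at.
  exact: sqrt_continuous.
by apply/funext => u; rewrite mxE.
Qed.

Lemma normalize2_sphere v : v != 0 -> sphere_set R L (normalize2 v).
Proof.
move=> /sum_sqr_gt0 v0; rewrite /sphere_set /= sum_sqrZ exprVn.
by rewrite sqr_sqrtr ?mulVf ?gt_eqF // ltW.
Qed.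

Lemma normalize2Z (a : R) v : 0 < a -> normalize2 (a *: v) = normalize2 v.
Proof.
move=> a0; rewrite /normalize2 sum_sqrZ sqrtrM ?sqr_ge0 // sqrtr_sqr gtr0_norm //.
by rewrite scalerA invfM mulrAC mulVf ?mul1r // gt_eqF.
Qed.

Lemma normalize2_id v : sphere_set R L v -> normalize2 v = v.
Proof. by rewrite /sphere_set /= /normalize2 => ->; rewrite sqrtr1 invr1 scale1r. Qed.

Lemma sphere_neq0 v : sphere_set R L v -> v != 0.
Proof.
rewrite /sphere_set /= => v1; apply/eqP => v0; move: v1; rewrite v0 big1.
  by move/eqP; rewrite eq_sym oner_eq0.
by move=> i _; rewrite mxE expr0n.
Qed.

Lemma sphere_valP (w : sphere) : sphere_set R L (set_val w).
Proof. exact: set_mem (valP w). Qed.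

(** The positive part of coordinate [i] sits at level [c_{i-1}] and the negative part at level
    [c_i]. With this choice of signs the base point of the sphere, the first basis vector, goes to
    the apex. *)
Definition cross_point c v : M := \matrix_(i < L.+1, b < k.+1)
  if b == prev_level c i then Num.max 0 (v ord0 i)
  else if b == c i then Num.max 0 (- v ord0 i) else 0.

Definition cross_coord c x : 'rV[R]_L.+1 :=
  \row_(i < L.+1) (x i (prev_level c i) - x i (c i)).

Lemma prev_level_neq c (i : row) : strict c L -> (c i == prev_level c i) = false.
Proof. by move=> cS; rewrite -val_eqE gtn_eqF // (prev_level_lt cS) // -ltnS. Qed.

Lemma cross_pointK c v : strict c L -> cross_coord c (cross_point c v) = v.
Proof.
move=> cS; apply/rowP => i; rewrite !mxE !eqxx prev_level_neq //.
by rewrite /Num.max; case: ltP => ?; case: ltP => ?; lra.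
Qed.

Lemma cross_pointZ c (a : R) v : 0 < a ->
  cross_point c (a *: v) = a *: cross_point c v.
Proof.
move=> a0; apply/matrixP => i b; rewrite !mxE -mulrN.
have maxZ u : Num.max 0 (a * u) = a * Num.max 0 u by rewrite maxr_pMr ?mulr0 ?ltW.
by rewrite !maxZ; case: eqP => // _; case: eqP => // _; rewrite mulr0.
Qed.

Lemma cross_coordZ c (a : R) x : cross_coord c (a *: x) = a *: cross_coord c x.
Proof. by apply/rowP => i; rewrite !mxE mulrBr. Qed.

Lemma cross_coordK c x : strict c L -> cone x -> cross c x ->
  cross_point c (cross_coord c x) = x.
Proof.
move=> cS [x0 xm _] cx; apply/matrixP => i b; rewrite !mxE.
(* Monotonicity allows one level per row, so the difference in [cross_coord] loses nothing. *)
have px : x i (prev_level c i) = 0 \/ x i (c i) = 0.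
  have [xp|] := eqVneq (x i (prev_level c i)) 0; [by left|move=> xp].
  have [xc|xc] := eqVneq (x i (c i)) 0; [by right|].
  have := xm _ _ _ _ xc xp (leqnn _); rewrite leqNgt.
  by rewrite (prev_level_lt cS) // -ltnS.
have x1 := x0 i (prev_level c i); have x2 := x0 i (c i).
have [->|bp] := eqVneq b (prev_level c i).
  case: px => E; move: x1 x2; rewrite E => x1 x2.
    by rewrite sub0r max_l // oppr_le0.
  by rewrite subr0 max_r.
have [->|bc] := eqVneq b (c i).
  rewrite opprB; case: px => E; move: x1 x2; rewrite E => x1 x2.
    by rewrite subr0 max_r.
  by rewrite sub0r max_l // oppr_le0.
apply/esym/eqP; apply: contraT => xb; have [bE|bE] := cx _ _ xb.
  by rewrite bE eqxx in bp.
by rewrite bE eqxx in bc.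
Qed.

Lemma cross_point_cross c v : cross c (cross_point c v).
Proof.
move=> i b; rewrite mxE; case: (b =P prev_level c i) => [|_]; first by left.
by case: (b =P c i) => [|_]; [right|rewrite eqxx].
Qed.

(** Within a row, a coordinate has only one sign. For rows [i < i'], the levels on row [i] are at
    most [c_i <= c_{i'-1}], and those on row [i'] are at least [c_{i'-1}]. *)
Lemma cross_point_cone c v : strict c L -> v != 0 -> cone (cross_point c v).
Proof.
move=> cS v0; split.
- by move=> i b; rewrite mxE; case: eqP => _; [|case: eqP => _]; rewrite ?le_max ?lexx.
- move=> i b i' b' yb yb'.
  have [bE b'E] := (cross_point_cross yb, cross_point_cross yb').
  have bc : (b <= c i)%N.
    by case: bE => ->; rewrite ?leqnn // ltnW // (prev_level_lt cS) // -ltnS.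
  have pb' : (prev_level c i' <= b')%N.
    by case: b'E => ->; rewrite ?leqnn // ltnW // (prev_level_lt cS) // -ltnS.
  rewrite leq_eqVlt => /predU1P[/val_inj ii'|ii'].
    rewrite -{}ii' in yb' b'E pb' *.
    case: bE => bE; first by rewrite bE.
    case: b'E => b'E; last by rewrite bE b'E.
    move: yb yb'; rewrite bE b'E !mxE !eqxx prev_level_neq //.
    have [vi|vi] := lerP 0 (v ord0 i); last by rewrite eqxx.
    by rewrite max_l ?eqxx // oppr_le0.
  have cp : (c i <= prev_level c i')%N.
    case: (i' : nat) (ltn_ord i') ii' => [//|j] jL; rewrite ltnS leq_eqVlt /=.
    by move=> /predU1P[-> //|ij]; rewrite ltnW // (strict_lt cS) // ltnW.
  by rewrite (leq_trans bc) // (leq_trans cp).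
- have [//|y0] := pselect (exists i b, cross_point c v i b != 0).
  move/eqP: v0; case; rewrite -(cross_pointK v cS); apply/rowP => i.
  have {}y0 b : cross_point c v i b = 0.
    by apply/eqP; apply: contra_notT y0 => ?; exists i, b.
  by rewrite mxE !y0 subrr mxE.
Qed.


End StaircaseComplex.

(** * The cross-polytopes as spheres, and the wedge decomposition *)

Section CrossPolytopes.
Variables (R : realType) (L k : nat).
Local Notation row := 'I_L.+1.
Local Notation level := 'I_k.+1.
Local Notation M := 'M[R]_(L.+1, k.+1).
Local Notation X := (staircase_space R L k).
Local Notation sphere := (sphere R L).
Local Notation apex := (apex R L k).
Implicit Types (c : nat -> level) (p : X) (w : sphere) (s : R).

Definition of_sphere c w : X :=
  to_space (normalize (cross_point c (set_val w))).

Definition to_sphere c p : sphere :=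
  insubd (sphere_base R L) (normalize2 (cross_coord c (set_val p))).

Definition cross_part c : set X := [set p : X | cross c (set_val p)].

(** Positivity at the vertices of [F_c] suffices: monotonicity excludes all other vertices, and
    openness is immediate in this form. *)
Definition facet_interior c : set X :=
  [set p : X | forall i : row, 0 < set_val p i (c i)].

Lemma insubd_sphereK (v : 'rV[R]_L.+1) : sphere_set R L v ->
  set_val (insubd (sphere_base R L) v : sphere) = v.
Proof. by move=> vS; apply: insubdK; exact: mem_set. Qed.

Lemma set_val_of_sphere c w : strict c L ->
  set_val (of_sphere c w) = normalize (cross_point c (set_val w)).
Proof.
move=> cS; apply/to_spaceK/normalize_staircase/cross_point_cone => //.
exact: sphere_neq0 (sphere_valP w).
Qed.

Lemma normalize_scale (x : M) : cone x -> exists2 a : R, 0 < a & normalize x = a *: x.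
Proof.
move=> [x0 _ xn]; exists (mass x)^-1 => //.
by rewrite invr_gt0 nonneg_mass_gt0.
Qed.

(** Both normalizations are positive rescalings, which the other one undoes, since [cross_point] and
    [cross_coord] are positively homogeneous. *)
Lemma of_sphereK c : strict c L -> cancel (of_sphere c) (to_sphere c).
Proof.
move=> cS w; apply: val_inj; rewrite /to_sphere set_val_of_sphere //.
have wS := sphere_valP w; have w0 := sphere_neq0 wS.
have [a a0 ->] := normalize_scale (cross_point_cone cS w0).
rewrite cross_coordZ cross_pointK // normalize2Z // normalize2_id //.
exact: insubd_sphereK.
Qed.

Lemma cross_coord_neq0 c p : strict c L -> cross_part c p ->
  cross_coord c (set_val p) != 0.
Proof.
move=> cS cp; have pC := space_cone p; apply/eqP => p0.
have [_ _ [i [b]]] := pC; rewrite -(cross_coordK cS pC cp) p0 !mxE maxxx.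
by rewrite oppr0 maxxx !if_same eqxx.
Qed.

Lemma to_sphereK c p : strict c L -> cross_part c p ->
  of_sphere c (to_sphere c p) = p.
Proof.
move=> cS cp; have pC := space_cone p; have v0 := cross_coord_neq0 cS cp.
apply: val_inj; rewrite -[LHS]/(set_val _) set_val_of_sphere // insubd_sphereK;
  last exact: normalize2_sphere.
rewrite /normalize2 cross_pointZ ?invr_gt0 ?sqrtr_gt0 ?sum_sqr_gt0 //.
rewrite normalizeZ ?invr_gt0 ?sqrtr_gt0 ?sum_sqr_gt0 // cross_coordK //.
by have [_ p1 _] := space_staircase p; rewrite normalize_id.
Qed.

Lemma of_sphere_cross c w : strict c L -> cross_part c (of_sphere c w).
Proof.
move=> cS i b; rewrite set_val_of_sphere // => /normalize_neq0.
exact: cross_point_cross.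
Qed.

Lemma of_sphere_base c : strict c L -> of_sphere c (sphere_base R L) = apex.
Proof.
move=> cS; apply: apexP => i b; rewrite set_val_of_sphere // => /normalize_neq0.
rewrite !mxE eqxx /=; case: (i =P ord0) => [->|_] /=; last first.
  by rewrite oppr0 maxxx !if_same eqxx.
case: (b =P ord0) => [//|_].
by rewrite (@max_l _ _ 0) ?if_same ?eqxx // oppr_le0 ler01.
Qed.

Lemma of_sphere_continuous c : strict c L -> continuous (of_sphere c).
Proof.
move=> cS w.
apply: (@to_space_continuous_at _ _ _ _
  (fun w : sphere => cross_point c (set_val w)) w).
  by move=> u; apply: cross_point_cone => //; exact: sphere_neq0 (sphere_valP u).
have cv i : {for w, continuous (fun u : sphere => set_val u ord0 i)}.
  apply: (@continuous_comp _ _ _ (set_val : sphere -> 'rV[R]_L.+1)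
    (fun x : 'rV[R]_L.+1 => x ord0 i)).
    exact: set_val_continuous.
  exact: coord_continuous.
move=> i b; rewrite (_ : (fun u => _) = fun u : sphere =>
   if b == prev_level c i then Num.max 0 (set_val u ord0 i)
   else if b == c i then Num.max 0 (- set_val u ord0 i) else 0).
  case: eqP => _.
    by apply: max_continuous_at; [exact: cst_continuous|exact: cv].
  case: eqP => _; last exact: cst_continuous.
  apply: max_continuous_at; first exact: cst_continuous.
  exact: (cvgN (cv i)).
by apply/funext => u; rewrite mxE.
Qed.

Lemma entry_continuous (i : row) (b : level) : continuous (fun p : X => set_val p i b).
Proof.
move=> p; apply: (@continuous_comp _ _ _ (set_val : X -> M) (fun x => x i b)).
  exact: set_val_continuous.
exact: coord_continuous.
Qed.

Lemma to_sphere_continuous_at c p : strict c L -> cross_part c p ->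
  {for p, continuous (to_sphere c)}.
Proof.
move=> cS cp; have v0 := cross_coord_neq0 cS cp.
have ccoord i : {for p, continuous (fun u : X => cross_coord c (set_val u) ord0 i)}.
  rewrite (_ : (fun u => _) = fun u : X =>
    set_val u i (prev_level c i) - set_val u i (c i)).
    exact: (cvgB (@entry_continuous i (prev_level c i) p)
      (@entry_continuous i (c i) p)).
  by apply/funext => u; rewrite mxE.
(* The signed coordinates stay nonzero on a full neighbourhood of [p] in [X], so [to_sphere] is
   given by its formula there, even off the cross-polytope. *)
have near_neq0 := @near_neq0_row _ _ _ _ _ ccoord v0.
apply: set_type_continuous_at.
apply: (@near_continuous _ _ _
    (fun u : X => normalize2 (cross_coord c (set_val u)))).
  apply: filterS near_neq0 => u u0 /=.
  by rewrite insubd_sphereK //; exact: normalize2_sphere.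
apply: matrix_continuous_at => i j; rewrite ord1.
exact: (@normalize2_continuous_at _ _ _ (fun u : X => cross_coord c (set_val u)) p).
Qed.

Lemma space_flow_cross c p s : cross_part c p -> cross_part c (space_flow (p, s)).
Proof.
move=> cp i b; rewrite set_val_space_flow => /normalize_neq0.
apply: flow_cross => //; [exact: space_cone|exact: clamp01].
Qed.

Lemma facet_interior_open c : open (facet_interior c).
Proof.
rewrite openE => p cp; rewrite /interior.
apply: (@filter_forall X row (fun i u => 0 < (set_val u : M) i (c i)) (nbhs p) _).
move=> i; have := @entry_continuous i (c i) p => /cvgr_gt; apply; exact: cp.
Qed.

Lemma facet_interior_cross c : facet_interior c `<=` cross_part c.
Proof.
move=> p cp i b pb; right; have [_ pm _] := space_cone p.
have pc : set_val p i (c i) != 0 by rewrite gt_eqF.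
by apply/val_inj/eqP; rewrite eqn_leq (pm _ _ _ _ pb pc) ?(pm _ _ _ _ pc pb).
Qed.

(** Each [c' i] is [c_{i-1}] or [c_i]. Inductively [c'] agrees with [c] on the previous row, and
    strictness of [c'] rules out the first value. *)
Lemma cross_facet_eq c c' p : strict c L -> strict c' L ->
  cross_part c p -> facet_interior c' p -> forall j : row, c j = c' j.
Proof.
move=> cS [c'0 c'S] cp c'p j.
have cases (i : row) : c' i = prev_level c i \/ c' i = c i.
  by apply: cp; rewrite gt_eqF.
case: j => j; elim: j => [|j IHj] jL.
  case: (cases (Ordinal jL)) => //= c'0E.
  by move: c'0; rewrite c'0E.
case: (cases (Ordinal jL)) => //= c'jE.
have := c'S j jL; rewrite c'jE.
by have /= -> := IHj (ltnW jL); rewrite ltnn.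
Qed.

Lemma facet_cover p : 
  (forall c, strict c L -> ~ facet_interior c p) ->
  space_flow (p, 1) = apex.
Proof.
move=> np; have [p0 _ _] := space_cone p; apply: space_flow1 => b.
apply/eqP; rewrite eq_le chain_ge0 // andbT leNgt; apply/negP => cb.
have [c [cS _ pc]] := chain_strict p0 (leqnn L) cb.
by apply: (np c cS) => i; rewrite -[i in set_val p i]inord_val pc // -ltnS.
Qed.

Lemma sphere_base_closed : closed [set sphere_base R L].
Proof.
have -> : [set sphere_base R L] =
    (set_val : sphere -> 'rV[R]_L.+1) @^-1` [set set_val (sphere_base R L)].
  apply/seteqP; split=> [w -> //|w /= wE]; exact: val_inj.
apply: closed_comp => [w _|]; first exact: set_val_continuous.
exact/accessible_closed_set1/hausdorff_accessible/norm_hausdorff.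
Qed.

Lemma staircase_space_equiv :
  homotopy_equiv R X (sphere_wedge R 'C(k, L.+1) L).
Proof.
have [cs [csS cs_inj cs_surj]] := strict_enum L k.
have off p : (forall i, ~ facet_interior (cs i) p) -> space_flow (p, 1) = apex.
  move=> np; apply: facet_cover => c cS cp.
  by have [i iE] := cs_surj c cS; apply: (np i) => j; rewrite iE.
(* Without strict sequences there is no facet interior, and the flow contracts the whole complex to
   the apex. *)
rewrite /sphere_wedge; case: posnP => [C0|C0].
  apply: (contractible_equiv (@space_flow_continuous R L k) (@space_flow0 R L k)).
  by move=> p; apply: off => i; have := ltn_ord i; rewrite [X in (_ < X)%N]C0.
apply: (@wedge_homotopy_equiv R X sphere (sphere_base R L) _ apex
  (@space_flow R L k) (fun i => cross_part (cs i))
  (fun i => facet_interior (cs i)) (fun i => of_sphere (cs i))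
  (fun i => to_sphere (cs i))) => //.
- exact: sphere_base_closed.
- exact: space_flow_continuous.
- exact: space_flow0.
- exact: space_flow_apex.
- by move=> i p s; exact: space_flow_cross.
- by move=> i; exact: facet_interior_open.
- by move=> i; exact: facet_interior_cross.
- by move=> i i' p ip ip'; apply: cs_inj;
    exact: (cross_facet_eq (csS i) (csS i') ip ip').
- by move=> i; exact: of_sphere_continuous.
- by move=> i w; exact: of_sphere_cross.
- by move=> i; exact: of_sphere_base.
- by move=> i; exact: of_sphereK.
- by move=> i p; exact: to_sphereK.
- by move=> i p; exact: to_sphere_continuous_at.
Qed.

End CrossPolytopes.

(** * Transfer between vertices of the path and matrix positions *)

Section Coordinates.
Variables (R : realType) (K : fieldType) (n k t L : nat).
Hypothesis nE : n = (k * t + L.+1)%N.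
Hypothesis Lt : (L < t)%N.
Local Notation row := 'I_L.+1.
Local Notation level := 'I_k.+1.
Local Notation M := 'M[R]_(L.+1, k.+1).
Local Notation X := (staircase_space R L k).
Local Notation Y := (realization R (Delta K n t k)).

Lemma vertex_subproof (i : row) (b : level) : (i + t * b < n)%N.
Proof. by rewrite nE; have := ltn_ord i; have := ltn_ord b; nia. Qed.

Definition vertex (i : row) (b : level) : 'I_n := Ordinal (vertex_subproof i b).

Definition to_matrix (x : 'rV[R]_n) : M := \matrix_(i, b) x ord0 (vertex i b).

(** Vertices beyond row [L] lie in no face, hence the coordinate 0. *)
Definition of_matrix (y : M) : 'rV[R]_n :=
  \row_q if (q %% t <= L)%N then y (inord (q %% t)%N) (inord (q %/ t)%N) else 0.

Lemma vertex_mod (i : row) (b : level) : (vertex i b %% t = i)%N.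
Proof. by rewrite /= addnC mulnC modnMDl modn_small // (leq_trans (ltn_ord i)). Qed.

Lemma vertex_div (i : row) (b : level) : (vertex i b %/ t = b)%N.
Proof.
rewrite /= addnC mulnC divnMDl ?divn_small ?addn0 //; last by lia.
exact: leq_trans (ltn_ord i) Lt.
Qed.

Lemma vertexK (q : 'I_n) : (q %% t <= L)%N ->
  vertex (inord (q %% t)%N) (inord (q %/ t)%N) = q.
Proof.
move=> qL; apply: val_inj; rewrite /= !inordK ?ltnS //.
  by rewrite addnC mulnC -divn_eq.
by have := ltn_ord q; have := divn_eq q t; nia.
Qed.

Lemma of_matrixK : cancel of_matrix to_matrix.
Proof.
move=> y; apply/matrixP => i b; rewrite !mxE vertex_mod vertex_div -ltnS ltn_ord.
by rewrite !inord_val.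
Qed.

Lemma to_matrixK (x : 'rV[R]_n) :
  (forall q : 'I_n, x ord0 q != 0 -> (q %% t <= L)%N) ->
  of_matrix (to_matrix x) = x.
Proof.
move=> xL; apply/rowP => q; rewrite !mxE; case: ifP => [qL|qL].
  by rewrite vertexK.
by apply/esym/eqP; apply: contraFT qL => /xL.
Qed.

Lemma mass_to_matrix (x : 'rV[R]_n) :
  (forall q : 'I_n, x ord0 q != 0 -> (q %% t <= L)%N) ->
  mass (to_matrix x) = \sum_q x ord0 q.
Proof.
move=> xL; rewrite [RHS](bigID (fun q : 'I_n => (q %% t <= L)%N)) /=.
rewrite [X in _ + X]big1 ?addr0; last first.
  by move=> q; apply: contraNeq => /xL.
rewrite /mass pair_bigA /=.
rewrite (reindex_onto (fun p : row * level => vertex p.1 p.2)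
  (fun q => (inord (q %% t)%N, inord (q %/ t)%N))) /=; last by move=> q; exact: vertexK.
apply: eq_big => [[i b]|[i b] _]; last by rewrite mxE.
have -> : (i + t * b = vertex i b)%N by [].
by rewrite vertex_mod vertex_div !inord_val eqxx andbT -ltnS ltn_ord.
Qed.

Lemma Delta_support (x : 'rV[R]_n) :
  Delta K n t k [set q | x ord0 q != 0]%SET <->
  staircase t L.+1 [set q | x ord0 q != 0]%SET.
Proof. by apply: Delta_staircase => //; rewrite ltnS leq0n. Qed.

Lemma realization_mod (x : 'rV[R]_n) :
  staircase t L.+1 [set q | x ord0 q != 0]%SET ->
  forall q : 'I_n, x ord0 q != 0 -> (q %% t <= L)%N.
Proof.
by move=> sx q xq; have [] := sx q q; rewrite ?inE // ltnS.
Qed.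

Definition to_staircase (x : Y) : X := to_space (to_matrix (set_val x)).

Lemma realizationP (x : Y) :
  [/\ forall q, 0 <= set_val x ord0 q, \sum_q set_val x ord0 q = 1
    & staircase t L.+1 [set q | set_val x ord0 q != 0]%SET].
Proof. by have [x0 x1 /Delta_support] := set_mem (valP x). Qed.

Lemma set_val_to_staircase (x : Y) :
  set_val (to_staircase x) = to_matrix (set_val x).
Proof.
have [x0 x1 sx] := realizationP x; apply: to_spaceK; split.
- by move=> i b; rewrite mxE.
- by rewrite mass_to_matrix //; exact: realization_mod.
- move=> i b i' b'; rewrite !mxE => xb xb'.
  have [] := sx (vertex i b) (vertex i' b'); rewrite ?inE //.
  by rewrite !vertex_mod !vertex_div.
Qed.

Lemma of_matrix_realization (y : M) : staircase_set y ->
  [/\ forall q, 0 <= of_matrix y ord0 q, \sum_q of_matrix y ord0 q = 1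
    & Delta K n t k [set q | of_matrix y ord0 q != 0]%SET].
Proof.
move=> [y0 y1 ym].
have yn (q : 'I_n) : of_matrix y ord0 q != 0 ->
    (q %% t <= L)%N /\ y (inord (q %% t)%N) (inord (q %/ t)%N) != 0.
  by rewrite mxE; case: ifP => //; rewrite eqxx.
have yL (q : 'I_n) : of_matrix y ord0 q != 0 -> (q %% t <= L)%N by case/yn.
have qk (q : 'I_n) : (q %/ t < k.+1)%N.
  by have := ltn_ord q; have := divn_eq q t; nia.
split.
- by move=> q; rewrite mxE; case: ifP.
- by rewrite -mass_to_matrix // of_matrixK.
- apply/Delta_support => q q'; rewrite !inE => /yn[qL yq] /yn[q'L yq'].
  split; first by rewrite ltnS.
  by have := ym _ _ _ _ yq yq'; rewrite !inordK.
Qed.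

Definition of_staircase (y : X) : Y :=
  exist _ (of_matrix (set_val y))
    (mem_set (of_matrix_realization (space_staircase y))).

Lemma realization_equiv : homotopy_equiv R Y (sphere_wedge R 'C(k, L.+1) L).
Proof.
apply: (@homotopy_equiv_homeo R Y X _ to_staircase of_staircase).
- move=> x; apply: set_type_continuous_at.
  rewrite (_ : _ \o _ = fun u : Y => to_matrix (set_val u)); last first.
    by apply/funext => u; exact: set_val_to_staircase.
  apply: matrix_continuous_at => i b.
  rewrite (_ : (fun u => _) = fun u : Y => set_val u ord0 (vertex i b)).
    apply: (@continuous_comp _ _ _ (set_val : Y -> 'rV[R]_n)
      (fun x : 'rV[R]_n => x ord0 (vertex i b))).
      exact: set_val_continuous.
    exact: coord_continuous.
  by apply/funext => u; rewrite mxE.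
- move=> y; apply: set_type_continuous_at.
  rewrite (_ : _ \o _ = fun u : X => of_matrix (set_val u)) //.
  apply: matrix_continuous_at => i q; rewrite ord1.
  rewrite (_ : (fun u => _) = fun u : X => if (q %% t <= L)%N then
      (set_val u : M) (inord (q %% t)%N) (inord (q %/ t)%N) else 0).
    case: (q %% t <= L)%N; last exact: cst_continuous.
    exact: entry_continuous.
  by apply/funext => u; rewrite mxE.
- move=> x; apply: val_inj; rewrite /= set_val_to_staircase to_matrixK //.
  by have [_ _ sx] := realizationP x; exact: realization_mod.
- by move=> y; rewrite /to_staircase /= of_matrixK to_space_val.
- exact: staircase_space_equiv.
Qed.

End Coordinates.

Theorem proposition3p6 (R : realType) (K : fieldType) (n k t l : nat) :
  (0 < t)%N -> n = (k * t + l)%N -> (1 <= l <= t)%N ->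
  homotopy_equiv R
    (realization R (Delta K n t k)) (sphere_wedge R 'C(k, l) l.-1).
Proof.
by case: l => [//|L] _ nE /= Lt; exact: (realization_equiv R K nE Lt).
Qed.
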